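(* Let $A\in Z_m([a,b])$ be a Shin--Zettl matrix of order $m$ on the finite interval $[a,b]$ with $A=A^+$, and let $L_{\min}$, $L_{\max}$ be the associated minimal and maximal quasi-differential operators in $L_2([a,b],\mathbb{C})$. Define linear maps $\Gamma_{[1]},\Gamma_{[2]}:\operatorname{Dom}(L_{\max})\to\mathbb{C}^m$ as follows. If $m=2n$ with $n\ge 2$, set $$\Gamma_{[1]}y := i^{2n}\bigl(-D^{[2n-1]}y(a),\,\ldots,\,(-1)^nD^{[n]}y(a),\;D^{[2n-1]}y(b),\,\ldots,\,(-1)^{n-1}D^{[n]}y(b)\bigr)^T,$$ $$\Gamma_{[2]}y := \bigl(D^{[0]}y(a),\,\ldots,\,D^{[n-1]}y(a),\;D^{[0]}y(b),\,\ldots,\,D^{[n-1]}y(b)\bigr)^T,$$ that is, for $k=1,\dots,n$ the $k$-th entry of $\Gamma_{[1]}y$ is $i^{2n}(-1)^kD^{[2n-k]}y(a)$ and its $(n+k)$-th entry is $i^{2n}(-1)^{k-1}D^{[2n-k]}y(b)$. If $m=2n+1$ with $n\in\mathbb{N}$, $n\ge 1$, set $$\Gamma_{[1]}y := i^{2n+1}\bigl(-D^{[2n]}y(a),\,\ldots,\,(-1)^nD^{[n+1]}y(a),\;D^{[2n]}y(b),\,\ldots,\,(-1)^{n-1}D^{[n+1]}y(b),\;\alpha D^{[n]}y(b)+\beta D^{[n]}y(a)\bigr)^T,$$ $$\Gamma_{[2]}y := \bigl(D^{[0]}y(a),\,\ldots,\,D^{[n-1]}y(a),\;D^{[0]}y(b),\,\ldots,\,D^{[n-1]}y(b),\;\gamma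 D^{[n]}y(b)+\delta D^{[n]}y(a)\bigr)^T,$$ that is, for $k=1,\dots,n$ the $k$-th entry of $\Gamma_{[1]}y$ is $i^{2n+1}(-1)^kD^{[2n+1-k]}y(a)$ and its $(n+k)$-th entry is $i^{2n+1}(-1)^{k-1}D^{[2n+1-k]}y(b)$, where $$\alpha=1,\quad \beta=1,\quad \gamma=\frac{(-1)^n}{2}+i,\quad \delta=\frac{(-1)^{n+1}}{2}+i.$$ Then $(\mathbb{C}^m,\Gamma_{[1]},\Gamma_{[2]})$ is a boundary triplet for $L_{\min}$.
   Context: Shin--Zettl matrices. $Z_m([a,b])$ is the set of $m\times m$ complex matrix-valued functions $A=(a_{k,s})$ on the finite interval $[a,b]$ such that $a_{k,s}\equiv 0$ for $s>k+1$, all entries $a_{k,s}\in L_1([a,b],\mathbb{C})$, and $a_{k,k+1}\ne 0$ a.e. on $[a,b]$ for $k=1,\dots,m-1$. Quasi-derivatives. Given $A$, define recursively $D^{[0]}y:=y$; $D^{[k]}y:=a_{k,k+1}^{-1}\bigl((D^{[k-1]}y)'-\sum_{s=1}^k a_{k,s}D^{[s-1]}y\bigr)$ for $k=1,\dots,m-1$; $D^{[m]}y:=(D^{[m-1]}y)'-\sum_{s=1}^m a_{m,s}D^{[s-1]}y$, on $\operatorname{Dom}(A):=\{y : D^{[k]}y\in AC([a,b],\mathbb{C}),\ k=0,\dots,m-1\}$. The quasi-differential expression is $l(y):=i^mD^{[m]}y$. Operators in $L_2([a,b],\mathbb{C})$. $L_{\max}y=l(y)$ with $\operatorname{Dom}(L_{\max})=\{y\in\operatorname{Dom}(A):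 D^{[m]}y\in L_2([a,b],\mathbb{C})\}$; $L_{\min}$ is the restriction of $L_{\max}$ to $\{y\in\operatorname{Dom}(L_{\max}): D^{[k]}y(a)=D^{[k]}y(b)=0,\ k=0,\dots,m-1\}$. Formal adjoint. $A^+:=-\Lambda_m^{-1}\overline{A^T}\Lambda_m$, where $\Lambda_m$ is the $m\times m$ matrix whose only non-zero entries are $(\Lambda_m)_{j,m+1-j}=(-1)^j$, $j=1,\dots,m$. When $A=A^+$ it is known that $L_{\min}$ is closed, densely defined and symmetric with deficiency indices $(m,m)$, and $L_{\min}^*=L_{\max}$, $L_{\max}^*=L_{\min}$. Boundary triplet. For a closed densely defined symmetric operator $T$ with equal deficiency indices in a Hilbert space $\mathcal{H}$ (inner products linear in the first argument), a triplet $(H,\Gamma_1,\Gamma_2)$, with $H$ a Hilbert space and $\Gamma_1,\Gamma_2:\operatorname{Dom}(T^* )\to H$ linear, is a boundary triplet for $T$ if (1) $(T^*f,g)_{\mathcal H}-(f,T^*g)_{\mathcal H}=(\Gamma_1f,\Gamma_2g)_H-(\Gamma_2f,\Gamma_1g)_H$ for all $f,g\in\operatorname{Dom}(T^* )$; (2) for all $g_1,g_2\in H$ there is $f\in\operatorname{Dom}(T^* )$ with $\Gamma_1f=g_1$ and $\Gamma_2f=g_2$. *)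

(* Defs.v *)
From HB Require Import structures.
From mathcomp Require Import all_boot all_order all_algebra.
From mathcomp Require Import complex.
From mathcomp Require Import all_classical all_reals all_analysis.

Set Implicit Arguments.
Unset Strict Implicit.
Unset Printing Implicit Defensive.

Import Order.TTheory GRing.Theory Num.Theory.
Import numFieldNormedType.Exports.

Local Open Scope classical_set_scope.
Local Open Scope ring_scope.

(* Operators in a Hilbert space are given by their graphs. The Hilbert space
   itself is presented by representatives: a linear space V, the subset S of
   the vectors that represent elements, and a form ip (linear in the first
   argument) on V which may vanish on nonzero vectors of S; two vectors of S
   represent the same element when their difference has ip-norm 0. Graphs are
   accordingly stable under replacing a vector by an equivalent one. *)
Section OperatorsInHilbertSpace.
Context {C : numClosedFieldType} {V : lmodType C}.
Implicit Types (S : set V) (ip : V -> V -> C) (T : set (V * V)).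

Definition op_dom T : set V := [set f | exists h, T (f, h)].

Definition op_adjoint S ip T : set (V * V) :=
  [set p | [/\ S p.1, S p.2 & forall q, T q -> ip q.2 p.1 = ip q.1 p.2]].

Definition linear_on {W : lmodType C} (D : set V) (G : V -> W) : Prop :=
  forall (c : C) (f g : V), D f -> D g -> G (c *: f + g) = c *: G f + G g.

(* The notion is meant for T closed, densely defined and symmetric with equal
   deficiency indices. As the adjoint is a graph, the Green identity is
   required for every pair of elements of that graph. *)
Definition boundary_triplet S ip T
    {W : lmodType C} (ipW : W -> W -> C) (G1 G2 : V -> W) : Prop :=
  let Tadj := op_adjoint S ip T in
  [/\ linear_on (op_dom Tadj) G1,
      linear_on (op_dom Tadj) G2,
      (forall f f' g g', Tadj (f, f') -> Tadj (g, g') ->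
         ip f' g - ip f g' = ipW (G1 f) (G2 g) - ipW (G2 f) (G1 g)) &
      (forall w1 w2 : W, exists f, [/\ op_dom Tadj f, G1 f = w1 & G2 f = w2])].

End OperatorsInHilbertSpace.

Definition cdot {C : numClosedFieldType} {m : nat} (u v : 'cV[C]_m) : C :=
  \sum_i u i 0 * (v i 0)^*.

Section FunctionsOnInterval.
Context {R : realType}.
Variables (a b : R).
Local Notation C := R[i].
Local Notation mu := (@lebesgue_measure R).
Implicit Types (f g : R -> C).

Definition cderive f : R -> C :=
  fun x => Complex (derive1 (fun t => complex.Re (f t)) x)
                   (derive1 (fun t => complex.Im (f t)) x).

Definition cintegral f : C :=
  Complex (\int[mu]_(x in `[a, b]) complex.Re (f x))
          (\int[mu]_(x in `[a, b]) complex.Im (f x)).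

(* lebesgue_measure lives on the Borel sets, hence measurability means Borel
   measurability here; every class of L_p contains such a representative. *)
Definition Lp (p : nat) f : Prop :=
  [/\ measurable_fun `[a, b] (fun x => complex.Re (f x)),
      measurable_fun `[a, b] (fun x => complex.Im (f x)) &
      mu.-integrable `[a, b] (fun x => (complex.Re `|f x| ^+ p)%:E)].

Definition L2_ip f g : C := cintegral (fun x => f x * (g x)^*).

Definition abs_cont f : Prop :=
  forall e : R, 0 < e -> exists2 d : R, 0 < d &
    forall (n : nat) (s t : 'I_n -> R),
      (forall i, a <= s i /\ s i <= t i /\ t i <= b) ->
      (forall i j, i != j -> t i <= s j \/ t j <= s i) ->
      \sum_i (t i - s i) < d ->
      \sum_i `|f (t i) - f (s i)| < (e%:C)%C.

(* The absolutely continuous representative of the class of f modulo equality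
   a.e. on [a, b] (it is unique on [a, b]), and f itself if there is none. *)
Definition ac_rep f : R -> C :=
  xget f [set g | abs_cont g /\ ae_eq mu `[a, b]%classic f g].

End FunctionsOnInterval.

(* Indices are shifted by one with respect to the usual numbering: rows and
   columns are numbered from 0. The value out of range is irrelevant. *)
Definition mxentry {C : nmodType} {m : nat} (M : 'M[C]_m) (k s : nat) : C :=
  if insub k is Some i then if insub s is Some j then M i j else 0 else 0.

Section QuasiDerivatives.
Context {R : realType}.
Variables (a b : R) (m : nat) (A : R -> 'M[R[i]]_m).
Local Notation C := R[i].
Local Notation mu := (@lebesgue_measure R).

(* Entries are elements of L_1, so that the pointwise conditions are imposed
   almost everywhere. *)
Definition shin_zettl : Prop :=
  [/\ (forall i j : 'I_m, (i.+1 < j)%N ->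
         ae_eq mu `[a, b]%classic (fun x => A x i j) (fun=> 0)),
      (forall i j : 'I_m, exists2 g : R -> C, Lp a b 1 g &
         ae_eq mu `[a, b]%classic (fun x => A x i j) g) &
      (forall i j : 'I_m, j = i.+1 :> nat ->
         {ae mu, forall x, x \in `[a, b] -> A x i j != 0})].

Definition Lambda_mx : 'M[C]_m :=
  \matrix_(i, j) (if j == rev_ord i then (-1) ^+ i.+1 else 0).

Definition formal_adjoint (x : R) : 'M[C]_m :=
  - (invmx Lambda_mx *m map_mx Num.conj (A x)^T *m Lambda_mx).

Definition qd_step (u : nat -> R -> C) (k : nat) : R -> C :=
  fun x => cderive (u k) x - \sum_(s < k.+1) mxentry (A x) k s * u s x.

(* [qd_upto y k j] is the j-th quasi-derivative of y, for j <= k <= m. As y is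
   an element of L_2 and the quotient by a_{k,k+1} is only defined a.e., the
   quasi-derivatives of order k < m are the absolutely continuous functions
   selected by ac_rep, if they exist; the last one is a class only. *)
Fixpoint qd_upto (y : R -> C) (k : nat) : nat -> R -> C :=
  if k is k'.+1 then
    let u := qd_upto y k' in
    fun j => if (j <= k')%N then u j
             else if (k'.+1 < m)%N then
               ac_rep a b (fun x => (mxentry (A x) k' k'.+1)^-1 * qd_step u k' x)
             else qd_step u k'
  else fun=> ac_rep a b y.

Definition quasi_derivative (k : nat) (y : R -> C) : R -> C := qd_upto y k k.
Local Notation D := quasi_derivative.

Definition quasi_dom : set (R -> C) :=
  [set y | forall k, (k < m)%N -> abs_cont a b (D k y)].

Definition quasi_diff_expr (y : R -> C) : R -> C :=
  fun x => ('i%C : C) ^+ m * D m y x.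

Definition L_max : set ((R -> C) * (R -> C)) :=
  [set p | [/\ Lp a b 2 p.1, Lp a b 2 p.2, quasi_dom p.1 &
               ae_eq mu `[a, b]%classic p.2 (quasi_diff_expr p.1)]].

Definition L_min : set ((R -> C) * (R -> C)) :=
  [set p | L_max p /\
     forall k, (k < m)%N -> D k p.1 a = 0 /\ D k p.1 b = 0].

(* The entries of the boundary maps for m = 2n and m = 2n+1; the last branch
   is reached only by the last entry in the odd case. For the first 2n entries,
   the k-th one (counted from 1) has index i = k - 1, and the (n+k)-th one has
   index i = n + k - 1. *)
Definition Gamma1 (n : nat) (y : R -> C) : 'cV[C]_m :=
  let alpha : C := 1 in
  let beta : C := 1 in
  \col_(i < m)
    (('i%C : C) ^+ m *
     (if (i < n)%N then
        let k := i.+1 in (-1) ^+ k * D (m - k) y a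
      else if (i < n.*2)%N then
        let k := (i - n).+1 in (-1) ^+ k.-1 * D (m - k) y b
      else alpha * D n y b + beta * D n y a)).

Definition Gamma2 (n : nat) (y : R -> C) : 'cV[C]_m :=
  let gamma : C := (-1) ^+ n / 2%:R + 'i%C in
  let delta : C := (-1) ^+ n.+1 / 2%:R + 'i%C in
  \col_(i < m)
     (if (i < n)%N then
        let k := i.+1 in D k.-1 y a
      else if (i < n.*2)%N then
        let k := (i - n).+1 in D k.-1 y b
      else gamma * D n y b + delta * D n y a).

End QuasiDerivatives.

(* Main.v *)
(* The paper quotes [L_min^* = L_max]; here it is proved. The quasi-derivatives
   [u_k] of [y] solve [u' = A u + h e_m] with [h = D^[m] y], and conversely. For
   solutions [u], [v] with right-hand sides [h], [g], the symmetry [A = A^+] makes the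
   derivative of the bracket [sum_k (-1)^k u_k conj(v_{m-1-k})] equal to
   [(-1)^(m-1) h conj(v_0) + u_0 conj(g)], which is the Lagrange identity.

   Let [v_1, ..., v_m] be the homogeneous solutions with unit initial data at [a]. The
   bracket of two of them is constant, so their values at [b] are independent, and
   their Gram matrix in [L_2] is invertible because [v_0] determines [v]. Hence
   the data at [a] and at [b] can be prescribed simultaneously, the right-hand side
   being a combination of the [v_j]; and every [f] orthogonal to the range of
   [L_min] is such a combination, which gives [L_min^* = L_max]. The maps
   [Gamma1], [Gamma2] are a linear change of coordinates on the boundary data that
   turns the bracket into the standard symplectic form.

   The analytic input is the fundamental theorem of calculus for absolutely
   continuous functions (by Radon-Nikodym, applied to the Stieltjes measures of the
   Jordan decomposition) and Caratheodory's existence theorem for linear systems with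
   integrable coefficients (by Picard iteration). *)

Require Import Defs.
From HB Require Import structures.
From mathcomp Require Import all_boot all_order all_algebra.
From mathcomp Require Import complex.
From mathcomp Require Import all_classical all_reals all_analysis.
From mathcomp Require Import measurable_realfun.
From mathcomp Require Import ring lra zify.
Import Order.TTheory GRing.Theory Num.Theory.
Import numFieldNormedType.Exports.
Local Open Scope classical_set_scope.
Local Open Scope ring_scope.

Set Implicit Arguments.
Unset Strict Implicit.
Unset Printing Implicit Defensive.

(** * Absolutely continuous functions of a real variable *)

(** The recursion for the quasi-derivatives divides by a_{k,k+1}, whose inverse need not be
    integrable. The first-order system contains only the entries of [A], so all the analysis is done
    on the predicate [sol]; [ac_rep] is met only in the passage between [sol] and [L_max].

    The adjoint can be computed because vanishing at both ends amounts to finitely many conditions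
    on the right-hand side. A solution with zero data at [a] and right-hand side h has at [b] the
    brackets (-1)^(m-1) (h, v_{j,0}) with the v_j, so it vanishes at [b] as soon as h is orthogonal
    to the m functions v_{j,0}. A projection onto their span then takes the place of a completeness
    argument in L_2.

    In the bracket the order k meets the order m-1-k. For odd m the middle order is its own partner,
    so its values at [a] and [b] have to be mixed into one coordinate of each boundary map; this is
    where the constants alpha, beta, gamma and delta come in. *)

Section RealAbsCont.
Context {R : realType}.
Variables (a b : R).
Local Notation mu := (@lebesgue_measure R).
Implicit Types (f g : R -> R).

Definition disjoint_itvs (I : finType) (s t : I -> R) : Prop :=
  (forall i, a <= s i /\ s i <= t i /\ t i <= b) /\
  (forall i j, i != j -> t i <= s j \/ t j <= s i).

(* Quantifying over all finite index types instead of ['I_n] allows an interval of the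
   family to be refined by a partition, the new index type being a sigma type. *)
Definition rac f : Prop :=
  forall e : R, 0 < e -> exists2 d : R, 0 < d &
    forall (I : finType) (s t : I -> R), disjoint_itvs s t ->
      \sum_i (t i - s i) < d -> \sum_i `|f (t i) - f (s i)| < e.

Lemma rac_ord f : (forall e : R, 0 < e -> exists2 d : R, 0 < d &
    forall (n : nat) (s t : 'I_n -> R), disjoint_itvs s t ->
      \sum_i (t i - s i) < d -> \sum_i `|f (t i) - f (s i)| < e) -> rac f.
Proof.
move=> H e /H[d d0 {}H]; exists d => // I s t [st1 st2].
rewrite (reindex (@enum_val I I)) /=; last first.
  by apply: onW_bij; exact: enum_val_bij.
rewrite [X in _ -> X < _](reindex (@enum_val I I)) /=; last first.
  by apply: onW_bij; exact: enum_val_bij.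
apply: (H _ (s \o enum_val) (t \o enum_val)); split => [i|i j ij] /=.
  exact: st1.
by apply: st2; rewrite (inj_eq enum_val_inj).
Qed.

Lemma rac_eq f g : (forall x, a <= x <= b -> f x = g x) -> rac f -> rac g.
Proof.
move=> fg H e /H[d d0 {}H]; exists d => // I s t st.
move=> /(H _ _ _ st); congr (_ < _); apply: eq_bigr => i _.
have [+ _] := st => /(_ i)[ai [si ti]].
by rewrite !fg ?ai ?ti ?(le_trans ai) ?(le_trans si).
Qed.

Lemma rac_cst c : rac (fun=> c).
Proof.
move=> e e0; exists 1 => // I s t _ _.
by rewrite big1 // => i _; rewrite subrr normr0.
Qed.

Lemma racD f g : rac f -> rac g -> rac (fun x => f x + g x).
Proof.
move=> Hf Hg e e0; have e2 : 0 < e / 2 by rewrite divr_gt0.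
have [d1 d10 H1] := Hf _ e2; have [d2 d20 H2] := Hg _ e2.
exists (Num.min d1 d2); first by rewrite lt_min d10 d20.
move=> I s t st; rewrite lt_min => /andP[/(H1 _ _ _ st) A1 /(H2 _ _ _ st) A2].
rewrite (splitr e); apply: le_lt_trans (ltrD A1 A2).
rewrite -big_split /=; apply: ler_sum => i _.
by rewrite opprD addrACA ler_normD.
Qed.

Lemma rac_lip f g (k : R) : 0 <= k -> rac f ->
  (forall x y, a <= x <= b -> a <= y <= b -> `|g y - g x| <= k * `|f y - f x|) ->
  rac g.
Proof.
(* The constant [k] may be 0, hence the division by [k + 1]. *)
move=> k0 Hf fg e e0; have k1 : 0 < k + 1 by rewrite ltr_wpDl.
have [d d0 H] := Hf _ (divr_gt0 e0 k1).
exists d => // I s t st /(H _ _ _ st); rewrite ltr_pdivlMr// => h.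
apply: le_lt_trans h; rewrite mulr_suml; apply: ler_sum => i _.
have [+ _] := st => /(_ i)[ai [si ti]].
apply: (le_trans (fg _ _ _ _)); first by rewrite ai (le_trans si).
  by rewrite ti (le_trans ai).
by rewrite mulrC ler_wpM2l // lerDl.
Qed.

Lemma racZ c f : rac f -> rac (fun x => c * f x).
Proof.
move=> H; apply: (rac_lip (normr_ge0 c) H) => x y _ _.
by rewrite -mulrBr normrM.
Qed.

Lemma racN f : rac f -> rac (fun x => - f x).
Proof. by move=> /(racZ (-1)); apply: rac_eq => x _; rewrite mulN1r. Qed.

Lemma racB f g : rac f -> rac g -> rac (fun x => f x - g x).
Proof. by move=> Hf /racN; exact: racD. Qed.

Lemma rac_sum (I : finType) (F : I -> R -> R) :
  (forall i, rac (F i)) -> rac (fun x => \sum_i F i x).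
Proof.
move=> H; apply: (@rac_eq (\sum_i F i)).
  by move=> x _; rewrite fct_sumE.
apply: (big_ind (fun f => rac f)); first exact: (rac_cst 0).
  by move=> f g; exact: racD.
by [].
Qed.

Lemma rac_unif f : rac f -> forall e, 0 < e -> exists2 d, 0 < d &
  forall x y, a <= x -> x <= y -> y <= b -> y - x < d -> `|f y - f x| < e.
Proof.
move=> Hf e /Hf[d d0 H]; exists d => // x y ax xy yb yx.
have := H unit (fun=> x) (fun=> y); rewrite !big_const card_unit /= !addr0.
by apply => //; split => // -[] [].
Qed.


(** Retraction of the line onto [a, b]: composing with it replaces continuity on [a, b] by
    continuity on the whole line. *)
Definition clip (x : R) : R := Num.min b (Num.max a x).

Hypothesis hab : a < b.

Lemma clip_itv x : a <= clip x <= b.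
Proof. by rewrite /clip le_min ge_min le_max lexx (ltW hab) /= lexx. Qed.

Lemma clip_id x : a <= x <= b -> clip x = x.
Proof. by case/andP => ax xb; rewrite /clip (max_idPr ax) (min_idPr xb). Qed.

Lemma clip_le x y : x <= y -> clip x <= clip y.
Proof.
move=> xy; rewrite /clip le_min ge_min lexx /= ge_min.
by rewrite (_ : Num.max a x <= Num.max a y) ?orbT // ge_max !le_max lexx xy orbT.
Qed.

Lemma clip_dist x y : x <= y -> clip y - clip x <= y - x.
Proof. rewrite /clip /Num.min /Num.max; do !case: ifPn; lra. Qed.

Lemma rac_clip_continuous f : rac f -> continuous (f \o clip).
Proof.
move=> Hf x; apply/(@cvgrPdist_lt _ R^o) => e e0.
have [d d0 H] := rac_unif Hf e0.
near=> y => /=.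
have xy : `|x - y| < d by near: y; apply: cvgr_dist_lt.
have [ax xb] := andP (clip_itv x); have [ay yb] := andP (clip_itv y).
case: (leP x y) => yx.
  rewrite distrC; apply: H => //; first exact: clip_le.
  by apply: le_lt_trans (clip_dist yx) _; rewrite -normrN opprB ger0_norm ?subr_ge0 // in xy.
apply: H => //; first exact/clip_le/ltW.
by apply: le_lt_trans (clip_dist (ltW yx)) _; rewrite ger0_norm ?subr_ge0 ?ltW // in xy.
Unshelve. all: by end_near. Qed.

Lemma rac_measurable f : rac f -> measurable_fun `[a, b] f.
Proof.
move=> /rac_clip_continuous /continuous_measurable_fun cf.
apply: (@eq_measurable_fun _ _ _ _ _ (f \o clip)).
  by move=> x; rewrite inE /= in_itv /= => /clip_id ->.
exact: measurable_funTS.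
Qed.

Lemma rac_bounded f : rac f -> exists2 K, 0 <= K & forall x, a <= x <= b -> `|f x| <= K.
Proof.
move=> Hf; have cf : continuous (fun x => `|(f \o clip) x|).
  by move=> x; apply: cvg_norm; exact: rac_clip_continuous.
have [c _ Hc] := EVT_max (ltW hab) (continuous_subspaceT cf).
exists `|(f \o clip) c| => // x xab.
by have /= := Hc x xab; rewrite clip_id.
Qed.

Lemma racM f g : rac f -> rac g -> rac (fun x => f x * g x).
Proof.
move=> Hf Hg; have [K K0 fK] := rac_bounded Hf; have [L L0 gL] := rac_bounded Hg.
(* An increment of the product is (f(t) - f(s)) g(t) + f(s) (g(t) - g(s)), which is dominated by the
   increments of [(L + 1) f] and [(K + 1) g]. *)
have Hf' : rac (fun x => (L + 1) * f x) by exact: racZ.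
have Hg' : rac (fun x => (K + 1) * g x) by exact: racZ.
move=> e e0; have e2 : 0 < e / 2 by rewrite divr_gt0.
have [d1 d10 H1] := Hf' _ e2; have [d2 d20 H2] := Hg' _ e2.
exists (Num.min d1 d2); first by rewrite lt_min d10 d20.
move=> I s t st; rewrite lt_min => /andP[/(H1 _ _ _ st) A1 /(H2 _ _ _ st) A2].
rewrite (splitr e); apply: le_lt_trans (ltrD A1 A2).
rewrite -big_split /=; apply: ler_sum => i _.
have [+ _] := st => /(_ i)[ai [si ti]].
have := fK (s i); have := gL (t i); rewrite ai ti (le_trans ai) //= (le_trans si) //=.
move=> /(_ isT) gt /(_ isT) fs.
have -> : f (t i) * g (t i) - f (s i) * g (s i) =
   (f (t i) - f (s i)) * g (t i) + f (s i) * (g (t i) - g (s i)) by ring.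
apply: (le_trans (ler_normD _ _)); rewrite -!mulrBr !normrM.
rewrite !(ger0_norm (addr_ge0 _ ler01)) // mulrC; apply: lerD.
  by rewrite ler_wpM2r // (le_trans gt) // lerDl.
by rewrite ler_wpM2r // (le_trans fs) // lerDl.
Qed.

(** If [K] bounds [f], the mean value theorem makes the exponential Lipschitz with constant [expR K]
    on the values of [f]. *)
Lemma rac_expR f : rac f -> rac (expR \o f).
Proof.
move=> Hf; have [K K0 fK] := rac_bounded Hf.
apply: (rac_lip (expR_ge0 K) Hf) => x y /fK fx /fK fy /=.
wlog : x y fx fy / f x <= f y => [H|xy].
  by case: (leP (f x) (f y)) => [/H|/ltW /H]; [exact | rewrite distrC [X in _ * X]distrC; exact].
have [-> | xy'] := eqVneq (f x) (f y); first by rewrite !subrr normr0 mulr0.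
have lt : f x < f y by rewrite lt_neqAle xy'.
have [|c + ->] := @MVT R expR expR _ _ lt (fun x _ => is_derive_expR x).
  exact/continuous_subspaceT/continuous_expR.
rewrite in_itv /= => /andP[c1 c2]; rewrite normrM ger0_norm ?expR_ge0 //.
rewrite ler_wpM2r // ler_expR (le_trans (ltW c2)) // (le_trans _ fy) //.
exact: ler_norm.
Qed.
End RealAbsCont.

(** * Variation of absolutely continuous functions *)

Section TotalVariation.
Context {R : realType}.
Variables (a b : R).
Hypothesis hab : a < b.
Implicit Types (f g : R -> R).
Local Notation BV := bounded_variation.
Local Notation TV := total_variation.

Lemma itv_partition_nth_leq (x y : R) (l : seq R) (i j : nat) :
  itv_partition x y l -> (i <= j <= size l)%N ->
  nth y (x :: l) i <= nth y (x :: l) j.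
Proof.
move=> [xl _] /andP[ij jl].
have xl' : sorted <=%O (x :: l) by apply: sub_path xl => u v /ltW.
have := @sorted_leq_nth _ _ (@le_trans _ R) (@lexx _ R) y _ xl' i j.
by rewrite !inE /= !ltnS; apply => //; exact: leq_trans jl.
Qed.

(** Subdividing the intervals of a family does not change their total length, so the [d] of absolute
    continuity serves for all subdivisions at once. *)
Lemma rac_variation f : rac a b f -> forall e, 0 < e -> exists2 d, 0 < d &
  forall (I : finType) (s t : I -> R) (l : I -> seq R), disjoint_itvs a b s t ->
    (forall i, itv_partition (s i) (t i) (l i)) ->
    \sum_i (t i - s i) < d -> \sum_i variation (s i) (t i) f (l i) < e.
Proof.
move=> Hf e /Hf[d d0 H]; exists d => // I s t l [st1 st2] lP.
pose P k i := nth (t i) (s i :: l i) k.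
pose s' (p : {i : I & 'I_(size (l i))}) := P (tagged p) (tag p).
pose t' (p : {i : I & 'I_(size (l i))}) := P (tagged p).+1 (tag p).
have Ple i j k : (j <= k <= size (l i))%N -> P j i <= P k i.
  exact: itv_partition_nth_leq.
have P0 i : P 0%N i = s i by [].
have Pl i : P (size (l i)) i = t i by exact: itv_partition_nth_size.
have H1 : disjoint_itvs a b s' t'.
  split=> [[i j]|[i j] [i' j'] ij] /=; rewrite /s' /t' /=.
    have [ai [_ ib]] := st1 i; split; first by rewrite (le_trans ai) // -P0 Ple //= ltnW.
    by split; [rewrite Ple ?leqnSn //= | rewrite (le_trans _ ib) // -Pl Ple // leqnn andbT].
  have [ii'|ii'] := eqVneq i i'; last first.
    have h1 : P j.+1 i <= t i by rewrite -Pl Ple // leqnn andbT.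
    have h2 : s i' <= P j' i' by rewrite -P0 Ple //= ltnW.
    have h3 : P j'.+1 i' <= t i' by rewrite -Pl Ple // leqnn andbT.
    have h4 : s i <= P j i by rewrite -P0 Ple //= ltnW.
    by case: (st2 _ _ ii') => h; [left|right]; lra.
  subst i'; have jj' : j != j' :> nat by apply: contraNneq ij => /val_inj ->.
  by case: (ltngtP j j') jj' => // h _; [left|right]; rewrite Ple // h ltnW.
(* Used twice: with [f] and the norm it gives the variations, with two identities it gives the
   lengths, which telescope. *)
have S (F : R -> R) (N : R -> R) : \sum_i \sum_(0 <= j < size (l i)) N (F (P j.+1 i) - F (P j i)) =
    \sum_p N (F (t' p) - F (s' p)).
  under eq_bigr do rewrite big_mkord.
  exact: (sig_big_dep (fun=> true) (fun=> fun=> true)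
    (fun i (j : 'I_(size (l i))) => N (F (P j.+1 i) - F (P j i)))).
move=> st; have := H _ _ _ H1; rewrite -(S f) -(S id id) /variation; apply.
suff -> : \sum_i \sum_(0 <= j < size (l i)) id (id (P j.+1 i) - id (P j i)) =
  \sum_i (t i - s i) by [].
by apply: eq_bigr => i _; rewrite (telescope_sumr (fun k => P k i)) // Pl P0.
Qed.

(** On an interval shorter than the [d] attached to [e = 1] every variation is below 1, and [a, b]
    is a chain of [N] such intervals. *)
Lemma rac_BV f : rac a b f -> BV a b f.
Proof.
move=> Hf; have [d d0 H] := rac_variation Hf ltr01.
have H1 x y : a <= x -> x <= y -> y <= b -> y - x < d -> BV x y f.
  move=> ax xy yb yx; exists 1 => _ [l lP <-].
  have := H unit (fun=> x) (fun=> y) (fun=> l).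
  rewrite !big_const card_unit /= !addr0 => h.
  by apply/ltW/h => //; split => // -[] [].
have [N _ HN] : exists2 N : nat, (0 < N)%N & (b - a) / d < N%:R.
  exists (Num.bound ((b - a) / d)).+1 => //.
  have h : 0 <= (b - a) / d by rewrite divr_ge0 // ?subr_ge0 ltW.
  by apply: lt_le_trans (archi_boundP h) _; rewrite ler_nat leqnSn.
have bd : b - a < N%:R * d by rewrite -ltr_pdivrMr.
have N0 : 0 < N%:R :> R.
  by rewrite -(pmulr_lgt0 _ d0) (lt_trans _ bd) // subr_gt0.
pose h := (b - a) / N%:R; pose x k := a + k%:R * h.
have h0 : 0 < h by rewrite divr_gt0 // subr_gt0.
have hd : h < d by rewrite ltr_pdivrMr // mulrC.
have xN : x N = b by rewrite /x /h mulrC mulrVK ?subrKC // unitfE gt_eqF.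
have xle k : (k <= N)%N -> x k <= b.
  by move=> kN; rewrite -xN /x lerD2l (ler_wpM2r (ltW h0)) // ler_nat.
have xS k : x k.+1 = x k + h by rewrite /x -natr1; ring.
have xge k : a <= x k by rewrite /x lerDl mulr_ge0 // ltW.
suff: forall k, (k <= N)%N -> BV a (x k) f by move/(_ N (leqnn _)); rewrite xN.
elim=> [_|k IH kN]; first by rewrite /x mul0r addr0; exact: bounded_variationxx.
apply/bounded_variationP => //.
have xx : x k <= x k.+1 by rewrite xS lerDl ltW.
rewrite (total_variationD f (xge k) xx) fin_numD.
apply/andP; split; first exact/bounded_variationP/IH/ltnW.
apply/bounded_variationP => //; apply: H1 => //; first exact: xle.
by rewrite xS addrAC subrr add0r.
Qed.

Lemma BVS f x y : rac a b f -> a <= x -> x <= y -> y <= b -> BV x y f.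
Proof.
move=> /rac_BV Hf ax xy yb.
exact: (bounded_variationr ax xy (bounded_variationl (le_trans ax xy) yb Hf)).
Qed.

Lemma TV_fin f x y : rac a b f -> a <= x -> x <= y -> y <= b -> TV x y f \is a fin_num.
Proof. by move=> Hf ax xy yb; apply/bounded_variationP => //; exact: BVS. Qed.

(** The Jordan decomposition is [f = tv f - (tv f - f)]; both terms are nondecreasing by
    [norm_le_tv]. *)
Definition tv f x := fine (TV a x f).

Lemma tvB f x y : rac a b f -> a <= x -> x <= y -> y <= b ->
  tv f y - tv f x = fine (TV x y f).
Proof.
move=> Hf ax xy yb; rewrite /tv (total_variationD f ax xy) fineD; first by ring.
  by apply: TV_fin => //; exact: le_trans yb.
exact: TV_fin.
Qed.

Lemma norm_le_tv f x y : rac a b f -> a <= x -> x <= y -> y <= b ->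
  `|f y - f x| <= tv f y - tv f x.
Proof.
move=> Hf ax xy yb; rewrite tvB // -lee_fin fineK; last exact: TV_fin.
exact: total_variation_ge.
Qed.

Lemma rac_tv f : rac a b f -> rac a b (tv f).
Proof.
move=> Hf e e0; have e2 : 0 < e / 2 by rewrite divr_gt0.
have [d d0 H] := rac_variation Hf e2; exists d => // I s t st std.
have [st1 _] := st.
have TVf i : TV (s i) (t i) f \is a fin_num.
  by have [? [? ?]] := st1 i; exact: TV_fin.
(* On each interval a partition is chosen whose variation misses the total one by less than this
   amount; the successor covers an empty index type. *)
have eta0 : 0 < e / 2 / (#|I|.+1)%:R by rewrite divr_gt0.
have HI i : exists l, itv_partition (s i) (t i) l /\
    tv f (t i) - tv f (s i) - e / 2 / (#|I|.+1)%:R < variation (s i) (t i) f l.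
  have [? [? ?]] := st1 i.
  have [_ [_ [l lP <-] <-] h] := ub_ereal_sup_adherent eta0 (TVf i).
  exists l; split => //; rewrite tvB // -lte_fin (le_lt_trans _ h) //.
  by rewrite EFinB fineK // lexx.
have [l lP] := choice HI.
have := H I s t l st (fun i => (lP i).1) std.
move=> hl; rewrite (splitr e).
apply: (@le_lt_trans _ _ (\sum_i (variation (s i) (t i) f (l i) + e / 2 / (#|I|.+1)%:R))).
  apply: ler_sum => i _; have [? [? ?]] := st1 i; have [_ hi] := lP i.
  rewrite ger0_norm; first by rewrite -lerBlDr ltW.
  by apply: le_trans (norm_le_tv _ _ _ _).
rewrite big_split /=; apply: ltr_leD => //.
rewrite sumr_const -[X in X <= _]mulr_natl mulrCA ler_piMr ?(ltW e2) //.
by rewrite ler_pdivrMr // mul1r ler_nat leqnSn.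
Qed.

End TotalVariation.

(** * Density of a monotone absolutely continuous function *)

Section MonotoneDensity.
Context {R : realType}.
Variables (a b : R).
Hypothesis hab : a < b.
Local Notation mu := (@lebesgue_measure R).

(* An open set is, inside [a, b], the increasing union of the finite families of the
   dyadic cells it contains; absolute continuity bounds the increments over each. *)
Let mesh (k : nat) : R := (b - a) / 2 ^+ k.
Let node (k j : nat) : R := a + j%:R * mesh k.
Let cell (k j : nat) : set R := `]node k j, node k j.+1]%classic.

Let mesh_gt0 k : 0 < mesh k.
Proof. by rewrite divr_gt0 ?exprn_gt0 // subr_gt0. Qed.

Let meshS k : mesh k = mesh k.+1 *+ 2.
Proof.
have h : 2 ^+ k != 0 :> R by rewrite expf_neq0.
by rewrite /mesh exprS mulr2n; field.
Qed.

Let nodeS k j : node k j.+1 = node k j + mesh k.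
Proof. by rewrite /node -natr1; ring. Qed.

Let node_le k : {homo node k : i j / (i <= j)%N >-> i <= j}.
Proof. by move=> i j ij; rewrite /node lerD2l (ler_wpM2r (ltW (mesh_gt0 k))) // ler_nat. Qed.

Let node_last k : node k (2 ^ k) = b.
Proof. by rewrite /node /mesh natrX mulrC mulrVK ?subrKC // unitfE expf_neq0. Qed.

Let node_double k j : node k.+1 j.*2 = node k j.
Proof. by rewrite /node (meshS k) -mul2n natrM; ring. Qed.

Let dyadic (U : set R) k : set R :=
  \big[setU/set0]_(j < 2 ^ k | `[< cell k j `<=` U >]) cell k j.

Let dyadicP U k x : dyadic U k x <->
  exists j, [/\ (j < 2 ^ k)%N, cell k j `<=` U & cell k j x].
Proof.
rewrite /dyadic -(bigcup_pred (fun j : 'I_(2 ^ k) => `[< cell k j `<=` U >]) (fun j => cell k j)).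
split=> [[j /= jU xj]|[j [jk jU xj]]].
  by exists j; split => //; move: jU; rewrite unfold_in => /asboolP.
by exists (Ordinal jk) => //=; rewrite unfold_in; apply/asboolP.
Qed.

Let measurable_dyadic U k : measurable (dyadic U k).
Proof. by apply: bigsetU_measurable => j _; exact: measurable_itv. Qed.

Let dyadic_nd U : nondecreasing_seq (dyadic U).
Proof.
apply/nondecreasing_seqP => k; apply/subsetPset => x /dyadicP[j [jk jU xj]].
have sub0 : cell k.+1 j.*2 `<=` cell k j.
  apply: subset_itv; rewrite bnd_simp ?node_double // -(node_double k j.+1).
  by apply: node_le; rewrite doubleS.
have sub1 : cell k.+1 j.*2.+1 `<=` cell k j.
  apply: subset_itv; rewrite bnd_simp -?doubleS ?node_double //.
  by rewrite -(node_double k j); apply: node_le.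
apply/dyadicP; case: (leP x (node k.+1 j.*2.+1)) => xm.
  exists j.*2; split; [by rewrite expnS mul2n ltn_double|exact: subset_trans jU|].
  move: xj; rewrite /cell /= !in_itv /= xm andbT node_double.
  by case/andP.
exists j.*2.+1; split; [|exact: subset_trans jU|].
  by rewrite expnS mul2n -doubleS ltn_Sdouble.
move: xj; rewrite /cell /= !in_itv /= xm /= -doubleS node_double.
by case/andP.
Qed.

(** A point of [U] is the centre of a ball inside [U], and the cell containing the point lies in
    that ball once the mesh is below the radius. The cells omit their left ends, so [a] is never
    covered. *)
Let bigcup_dyadic U : open U -> \bigcup_k dyadic U k = U `&` `]a, b].
Proof.
move=> oU; apply/seteqP; split => [x [k _ /dyadicP[j [jk jU xj]]]|x [Ux]].
  split; first exact: jU.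
  move: xj; rewrite /cell /= !in_itv /= => /andP[jx xj].
  have := @node_le k 0%N j (leq0n j); rewrite {1}/node mul0r addr0 => h0.
  by rewrite (le_lt_trans h0) //= (le_trans xj) // -(node_last k) node_le.
rewrite /= in_itv /= => /andP[ax xb].
have [e /= e0 eU] : nbhs_ball x U by rewrite nbhs_ballE; exact: open_nbhs_nbhs.
have [k ke] : exists k, mesh k < e.
  have h : 0 <= (b - a) / e by rewrite divr_ge0 ?subr_ge0 // ltW.
  exists (Num.bound ((b - a) / e)); rewrite /mesh ltr_pdivrMr ?exprn_gt0 //.
  rewrite mulrC -ltr_pdivrMr //; apply: lt_le_trans (archi_boundP h) _.
  by rewrite -natrX ler_nat ltnW // ltn_expl.
have exj : exists j, x <= node k j by exists (2 ^ k)%N; rewrite node_last.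
case: (ex_minnP exj) => -[|j] xj jmin.
  by move: xj; rewrite /node mul0r addr0 leNgt ax.
have jx : node k j < x.
  by rewrite ltNge; apply/negP => /jmin; rewrite ltnn.
exists k => //; apply/dyadicP; exists j; split.
- by apply: jmin; rewrite node_last.
- move=> y; rewrite /cell /= !in_itv /= => /andP[jy yj]; apply: eU => /=.
  rewrite /ball /= ltr_distlC; rewrite nodeS in xj yj; lra.
- by rewrite /cell /= in_itv /= jx.
Qed.

Let trivIset_cell k : trivIset setT (fun j : 'I_(2 ^ k) => cell k j).
Proof.
move=> i j _ _ [x []]; rewrite /cell /= !in_itv /= => /andP[ix xi] /andP[jx xj].
apply/val_inj; case: (ltngtP i j) => // h; exfalso.
  by have := le_lt_trans (le_trans xi (@node_le k _ _ h)) jx; rewrite ltxx.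
by have := le_lt_trans (le_trans xj (@node_le k _ _ h)) ix; rewrite ltxx.
Qed.

Let mu_cell k j : mu (cell k j) = (node k j.+1 - node k j)%:E.
Proof. by rewrite lebesgue_measure_itv /= lte_fin nodeS ltrDl mesh_gt0 EFinB. Qed.

Let mu_dyadic U k : mu (dyadic U k) =
  (\sum_(j < 2 ^ k | `[< cell k j `<=` U >]) (node k j.+1 - node k j))%:E.
Proof.
rewrite /dyadic measure_bigsetU_ord //; last by move=> i; exact: measurable_itv.
by rewrite -sumEFin; apply: eq_bigr => j _; exact: mu_cell.
Qed.

Variable V : R -> R.
Hypothesis racV : rac a b V.
Hypothesis ndV : forall x y, a <= x -> x <= y -> y <= b -> V x <= V y.

(** Extended by constants, [V] becomes monotone and right-continuous on the whole line, as a
    Stieltjes measure requires. *)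
Let F := V \o clip a b.

Let ndF : nondecreasing F.
Proof.
move=> x y xy; have [ax xb] := andP (clip_itv hab x).
have [ay yb] := andP (clip_itv hab y).
by apply: ndV => //; exact: clip_le.
Qed.

Let rcF : forall x, F t @[t --> x^'+] --> F x.
Proof. by apply: right_continuousW; exact: rac_clip_continuous. Qed.

HB.instance Definition _ := isCumulative.Build R _ R F ndF rcF.

Let nu : set (measurableTypeR R) -> \bar R := lebesgue_stieltjes_measure F.

HB.instance Definition _ := Measure.on nu.

Let nu_itv x y : x <= y -> nu `]x, y] = (F y - F x)%:E.
Proof.
move=> xy; rewrite /nu /lebesgue_stieltjes_measure /measure_extension.
by rewrite measurable_mu_extE /=; [rewrite wlength_itv_bnd|exact: is_ocitv].
Qed.

Let nu_ab_fin : (nu `]a, b] < +oo)%E.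
Proof. by rewrite nu_itv ?ltry // ltW. Qed.

Let mab : measurable (`]a, b]%classic : set (measurableTypeR R)).
Proof. exact: measurable_itv. Qed.

Let nu' := mfrestr mab nu_ab_fin.

HB.instance Definition _ := FiniteMeasure.on nu'.

(** By outer regularity a null set lies in an open [U] of measure below the [d] of [racV]. The
    finitely many cells of a given level inside [U] then have [nu]-mass at most [e], and the mass of
    [U] in ]a, b] is the limit of these masses. *)
Let nu_dom : nu' `<< mu.
Proof.
apply/null_content_dominatesP => N mN muN.
rewrite /nu' /mfrestr /mrestr.
apply/eqP; rewrite eq_le measure_ge0 andbT; apply/lee_addgt0Pr => e e0.
rewrite add0e.
have [d d0 H] := racV e0.
have [|U [oU NU]] := @lebesgue_regularity_outer R N d mN _ d0.
  by rewrite muN.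
move=> UN.
have {UN} Ud : (mu U < d%:E)%E.
  rewrite -(setDUK NU) measureU ?setDIK //.
    by rewrite [X in (X + _)%E](_ : _ = 0)%E ?add0e.
  by apply: measurableD => //; exact: open_measurable.
apply: (@le_trans _ _ (nu (U `&` `]a, b]))).
  apply: le_measure; rewrite ?inE; first exact: measurableI.
    by apply: measurableI => //; exact: open_measurable.
  exact: setSI.
rewrite -bigcup_dyadic //.
have := @nondecreasing_cvg_mu _ _ _ nu (dyadic U) (measurable_dyadic U)
  (bigcup_measurable (fun k _ => measurable_dyadic U k)) (@dyadic_nd U).
move=> cv; have E := cvg_lim (@ereal_hausdorff R) cv.
apply: (@le_trans _ _ (limn (nu \o dyadic U))); first by rewrite E.
apply: lime_le; first by apply/cvg_ex; eexists; exact: cv.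
apply: nearW => k /=.
have : (mu (dyadic U k) < d%:E)%E.
  apply: le_lt_trans Ud; apply: le_measure; rewrite ?inE.
  - exact: measurable_dyadic.
  - exact: open_measurable.
  by move=> x /dyadicP[j [_ jU /jU]].
rewrite mu_dyadic lte_fin => hd.
have -> : nu (dyadic U k) =
    (\sum_(j < 2 ^ k | `[< cell k j `<=` U >]) nu (cell k j))%E.
  by apply: measure_bigsetU_ord => // i; exact: measurable_itv.
(* Cells not contained in [U] are shrunk to a point, so that the family is indexed by all of
   ['I_(2 ^ k)] without changing the sums. *)
pose t (j : 'I_(2 ^ k)) := if `[< cell k j `<=` U >] then node k j.+1 else node k j.
have nodeab j : (j <= 2 ^ k)%N -> a <= node k j <= b.
  move=> jk; rewrite -(node_last k) node_le // andbT.
  by have := @node_le k 0%N j (leq0n j); rewrite {1}/node mul0r addr0.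
have st : disjoint_itvs a b (fun j : 'I_(2 ^ k) => node k j) t.
  split=> [j|i j ij].
    have /andP[? ?] := nodeab j (ltnW (ltn_ord j)); have /andP[? ?] := nodeab j.+1 (ltn_ord j).
    by rewrite /t; case: ifP => _; do 2!split => //; exact: node_le.
  have tle (i' : 'I_(2 ^ k)) : t i' <= node k i'.+1.
    by rewrite /t; case: ifP => _ //; exact: node_le.
  have : (i < j)%N \/ (j < i)%N by move: ij; rewrite -val_eqE neq_ltn => /orP.
  by case=> h; [left|right]; apply: le_trans (tle _) _; exact: node_le.
have /(H _ _ _ st) : \sum_j (t j - node k j) < d.
  apply: le_lt_trans hd; rewrite le_eqVlt; apply/orP; left; apply/eqP.
  rewrite [RHS]big_mkcond; apply: eq_bigr => j _.
  by rewrite /t; case: ifP => //; rewrite subrr.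
move=> /ltW; rewrite -lee_fin; apply: le_trans.
rewrite -sumEFin big_mkcond /=; apply: lee_sum => j _; rewrite /t.
case: ifP => _; last by rewrite lee_fin.
rewrite nu_itv; last exact: node_le.
have h1 := nodeab j (ltnW (ltn_ord j)); have h2 := nodeab j.+1 (ltn_ord j).
by rewrite /F /= !clip_id // lee_fin ler_norm.
Qed.

Lemma monotone_rac_density : exists2 g : R -> R,
  mu.-integrable setT (EFin \o g) &
  forall x, a <= x <= b -> V x = V a + \int[mu]_(t in `[a, x]) g t.
Proof.
have [g [g0 gfin gint gP]] := radon_nikodym_sigma_finite (mu := mu) nu_dom.
exists (fine \o g).
  by apply: eq_integrable gint => // x _ /=; rewrite fineK.
move=> x /andP[ax xb]; have := gP _ (measurable_itv `]a, x]).
rewrite /= {1}/nu' /mfrestr /mrestr setIidl; last by apply: subset_itvl; rewrite bnd_simp.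
have Fx : F x = V x by rewrite /F /= clip_id // ax.
have Fa : F a = V a by rewrite /F /= clip_id // lexx ltW.
have gi : mu.-integrable `]a, x] (EFin \o (fine \o g)).
  apply: (@eq_integrable _ _ _ _ _ _ g) => //; first by move=> y _ /=; rewrite fineK.
  exact: integrableS gint.
rewrite nu_itv // Fx Fa -Rintegral_itv_obnd_cbnd // /Rintegral => h.
under eq_integral do rewrite /= fineK //.
by rewrite -h /= addrC subrK.
Qed.

End MonotoneDensity.

#[local] Instance ae_lebesgue_filter (R : realType) :
  Filter (nbhs (almost_everywhere (@lebesgue_measure R))).
Proof. exact: (ae_filter_ringOfSetsType lebesgue_measure). Qed.

(** * Properties holding almost everywhere on an interval *)

Section AlmostEverywhere.
Context {R : realType}.
Variables (a b : R).
Local Notation mu := (@lebesgue_measure R).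

(** The open interval is chosen because [derive1] at an end point depends on values outside [a, b],
    about which nothing is known. The end points form a null set, so the passage to [a, b] is
    free. *)
Definition aei (P : R -> Prop) : Prop := {ae mu, forall x, a < x < b -> P x}.

Lemma aei_ae (P : R -> Prop) : aei P -> {ae mu, forall x, `[a, b]%classic x -> P x}.
Proof.
move=> H.
have set1 c : {ae mu, forall x, x != c}.
  exists [set c]; split; first by rewrite -set_itv1; exact: measurable_itv.
    by rewrite lebesgue_measure_set1.
  by move=> x /= /negP; rewrite negbK => /eqP ->.
move: H (set1 a) (set1 b); rewrite /aei; apply: filterS3 => x H xa xb.
rewrite /= in_itv /= => /andP[ax xb'].
by apply: H; rewrite !lt_neqAle ax xb' eq_sym xa xb.
Qed.

Lemma ae_aei (P : R -> Prop) : {ae mu, forall x, `[a, b]%classic x -> P x} -> aei P.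
Proof.
rewrite /aei; apply: filterS => x H /andP[ax xb]; apply: H.
by rewrite /= in_itv /= !ltW.
Qed.

Lemma aeiS (P Q : R -> Prop) : (forall x, a < x < b -> P x -> Q x) -> aei P -> aei Q.
Proof. by move=> PQ; rewrite /aei; apply: filterS => x H xab; apply: PQ => //; exact: H. Qed.

Lemma aeiS2 (P Q S : R -> Prop) : (forall x, a < x < b -> P x -> Q x -> S x) ->
  aei P -> aei Q -> aei S.
Proof.
move=> PQ; rewrite /aei; apply: filterS2 => x H K xab.
by apply: PQ => //; [exact: H|exact: K].
Qed.

Lemma aei_and (P Q : R -> Prop) : aei P -> aei Q -> aei (fun x => P x /\ Q x).
Proof. by apply: aeiS2. Qed.

Lemma aei_forall (I : finType) (P : I -> R -> Prop) :
  (forall i, aei (P i)) -> aei (fun x => forall i, P i x).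
Proof.
move=> H; have := filter_forall (ae_lebesgue_filter R) H.
by rewrite /aei; apply: filterS => x Hx xab i; exact: Hx.
Qed.

Lemma aeiW (P : R -> Prop) : (forall x, a < x < b -> P x) -> aei P.
Proof. by move=> H; apply: aeW => x /H. Qed.

End AlmostEverywhere.

(** * Primitives and the fundamental theorem of calculus *)

Section Primitives.
Context {R : realType}.
Variables (a b : R).
Hypothesis hab : a < b.
Local Notation mu := (@lebesgue_measure R).
Implicit Types (f g F G : R -> R).

Definition L1 f : Prop := mu.-integrable `[a, b] (EFin \o f).
Definition prim f x : R := \int[mu]_(t in `[a, x]) f t.

Lemma L1S f (D : set R) : measurable D -> D `<=` `[a, b] -> L1 f ->
  mu.-integrable D (EFin \o f).
Proof. by move=> mD Dab; apply: integrableS. Qed.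

Lemma L1S_itv f x : x <= b -> L1 f -> mu.-integrable `[a, x] (EFin \o f).
Proof. by move=> xb; apply: L1S => //; apply: subset_itvl; rewrite bnd_simp. Qed.

Lemma L1D f g : L1 f -> L1 g -> L1 (fun x => f x + g x).
Proof.
move=> Hf Hg; rewrite /L1 (_ : EFin \o _ = (EFin \o f) \+ (EFin \o g))%E //.
exact: integrableD.
Qed.

Lemma L1Z c f : L1 f -> L1 (fun x => c * f x).
Proof.
move=> Hf; rewrite /L1 (_ : EFin \o _ = (fun x => c%:E * (EFin \o f) x))%E //.
exact: integrableZl.
Qed.

Lemma L1N f : L1 f -> L1 (fun x => - f x).
Proof.
by move=> /(L1Z (-1)); rewrite (_ : (fun x => _) = \- f) // funeqE => x; rewrite mulN1r.
Qed.

Lemma L1B f g : L1 f -> L1 g -> L1 (fun x => f x - g x).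
Proof. by move=> Hf /L1N; exact: L1D. Qed.

Lemma L1_0 : L1 (fun=> 0).
Proof. exact: integrable0. Qed.

Lemma L1_sum (I : finType) (f : I -> R -> R) :
  (forall i, L1 (f i)) -> L1 (fun x => \sum_i f i x).
Proof.
move=> H; rewrite (_ : (fun x => _) = \sum_i f i); last by apply/funext => x; rewrite fct_sumE.
apply: (big_ind (fun f => L1 f)); first exact: L1_0.
  by move=> u v; exact: L1D.
by [].
Qed.

Lemma L1_norm f : L1 f -> L1 (fun x => `|f x|).
Proof. exact: integrable_norm. Qed.

Lemma L1_measurable f : L1 f -> measurable_fun `[a, b] f.
Proof. by move=> /integrableP[/measurable_EFinP]. Qed.

Lemma L1_le f g : measurable_fun `[a, b] f -> (forall x, a <= x <= b -> `|f x| <= g x) ->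
  L1 g -> L1 f.
Proof.
move=> mf fg; apply: le_integrable => //; first exact/measurable_EFinP.
move=> x; rewrite /= in_itv /= => /fg h; rewrite lee_fin (le_trans h) //.
exact: ler_norm.
Qed.

Lemma mu_fin : (mu `[a, b] < +oo)%E.
Proof. by rewrite lebesgue_measure_itv /= lte_fin hab ltry. Qed.

Lemma L1_bounded f K : measurable_fun `[a, b] f ->
  (forall x, a <= x <= b -> `|f x| <= K) -> L1 f.
Proof.
move=> mf fK; apply: measurable_bounded_integrable => //; first exact: mu_fin.
exists K; split; first exact: num_real.
by move=> L KL x /= xab; apply: le_trans (ltW KL); apply: fK; rewrite in_itv in xab.
Qed.

Lemma L1_cst (K : R) : L1 (fun=> K).
Proof. by apply: (@L1_bounded _ `|K|). Qed.

Lemma L1_rac F : rac a b F -> L1 F.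
Proof.
move=> HF; have [K _ FK] := rac_bounded hab HF.
by apply: L1_bounded FK; exact: rac_measurable.
Qed.

Lemma L1Mb f g K : measurable_fun `[a, b] g -> (forall x, a <= x <= b -> `|g x| <= K) ->
  L1 f -> L1 (fun x => f x * g x).
Proof.
move=> mg gK Hf; apply: (@L1_le _ (fun x => K * `|f x|)).
- by apply: measurable_funM => //; exact: L1_measurable.
- by move=> x /gK h; rewrite normrM mulrC ler_wpM2r.
- exact/L1Z/L1_norm.
Qed.

Lemma L1M f G : rac a b G -> L1 f -> L1 (fun x => f x * G x).
Proof.
by move=> HG; have [K _ GK] := rac_bounded hab HG; apply: (L1Mb _ GK); exact: rac_measurable.
Qed.

Lemma prim_ae f g x : x <= b -> L1 f -> L1 g -> aei a b (fun x => f x = g x) ->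
  prim f x = prim g x.
Proof.
move=> xb Hf Hg /aei_ae fg; rewrite /prim /Rintegral; congr fine.
have xs : `[a, x] `<=` `[a, b] by apply: subset_itvl; rewrite bnd_simp.
apply: ae_eq_integral => //.
- exact: measurable_int (L1S_itv xb Hf).
- exact: measurable_int (L1S_itv xb Hg).
- by apply: filterS fg => y H /xs /H /= ->.
Qed.

Lemma prim_a f : prim f a = 0.
Proof. by rewrite /prim set_itv1 Rintegral_set1. Qed.

Lemma primB f x y : L1 f -> a <= x -> x <= y -> y <= b ->
  prim f y - prim f x = \int[mu]_(t in `]x, y]) f t.
Proof. by move=> Hf ax xy yb; rewrite /prim Rintegral_itvB //; exact: L1S_itv. Qed.

(** This is the smallness of the integral of |f| over sets of small measure, applied to the union of
    the intervals of the family. *)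
Lemma prim_rac f : L1 f -> rac a b (prim f).
Proof.
move=> Hf e e0.
have Hf' : mu.-integrable setT (EFin \o (f \_ `[a, b])).
  by rewrite -restrict_EFin -integrable_mkcond.
have [d [d0 H]] := integral_normr_continuous Hf' e0.
exists d => // I s t [st1 st2] std.
(* Half-open intervals are disjoint even where the closed ones share an end point. *)
pose c i : set R := `]s i, t i]%classic.
have cab i : c i `<=` `[a, b].
  have [? [? ?]] := st1 i.
  by apply: subset_itv; rewrite bnd_simp.
have mc i : measurable (c i) by exact: measurable_itv.
pose D := \big[setU/set0]_(i <- index_enum I) c i.
have tc : trivIset [set` index_enum I] c.
  move=> i j _ _ [x []]; rewrite /c /= !in_itv /= => /andP[ix xi] /andP[jx xj].
  apply/eqP; apply: contraT => /st2[] h.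
    by have := le_lt_trans (le_trans xi h) jx; rewrite ltxx.
  by have := le_lt_trans (le_trans xj h) ix; rewrite ltxx.
have mD : measurable D by apply: bigsetU_measurable.
have muD : (mu D < d%:E)%E.
  have intc (E : set R) : measurable E -> (\int[mu]_(x in E) (cst 1%E) x = mu E)%E.
    by move=> mE; rewrite integral_cst // mul1e.
  have : (\int[mu]_(x in D) (cst 1%E) x =
      \sum_(i <- index_enum I) \int[mu]_(x in c i) (cst 1%E) x)%E.
    by apply: ge0_integral_bigsetU => //; exact: index_enum_uniq.
  rewrite (intc _ mD) => ->.
  move: std; rewrite -lte_fin -sumEFin; apply: le_lt_trans.
  apply: lee_sum => i _; rewrite (intc _ (mc i)) lebesgue_measure_itv /=.
  have [_ [sti _]] := st1 i.
  by case: ifP => _; [rewrite EFinB | rewrite lee_fin subr_ge0].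
have {H} := H D mD muD; apply: le_lt_trans.
have quasi_derivativeS : D `<=` `[a, b].
  rewrite /D; apply: (big_ind (fun X => X `<=` `[a, b])) => [x []|X Y HX HY x [/HX|/HY]|i _] //.
have Dn : mu.-integrable D (EFin \o (fun x => `|f x|)) by apply: L1S => //; exact: L1_norm.
have -> : \int[mu]_(x in D) `|(f \_ `[a, b]) x| = \int[mu]_(x in D) `|f x|.
  apply: eq_Rintegral => x; rewrite inE => /quasi_derivativeS xD.
  by rewrite patchE mem_set.
rewrite /Rintegral integral_bigsetU_EFin ?index_enum_uniq //; last exact: (measurable_int mu).
rewrite -sum_fine; last first.
  move=> i _; apply: integrable_fin_num; first exact: mc.
  have hn : mu.-integrable (c i) (EFin \o (fun x => `|f x|)).
    by apply: L1S => //; exact: L1_norm.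
  exact: hn.
apply: ler_sum => i _; have [? [? ?]] := st1 i.
rewrite primB //; apply: le_normr_Rintegral; first exact: measurable_itv.
by apply: L1S => //; exact: cab.
Qed.

(** Lebesgue differentiation, applied to the extension of [f] by 0; near an interior point the
    extension has the same primitive. *)
Lemma prim_deriv f : L1 f -> aei a b (fun x => is_derive x 1 (prim f) (f x)).
Proof.
move=> Hf; pose f' := f \_ `[a, b].
have Hf' : mu.-integrable setT (EFin \o f').
  by rewrite -restrict_EFin -integrable_mkcond.
have Hy y : mu.-integrable [set` Interval (BLeft a) (BRight y)] (EFin \o f').
  by apply: integrableS Hf'.
have := FTC1 Hy (open_integrable_locally openT Hf').
rewrite /aei; apply: filterS => x H /andP[ax xb].
have {H}[|H1 H2] := H; first by rewrite lte_fin.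
have E : {near x, (fun y => \int[mu]_(t in `[a, y]) f' t) =1 prim f}.
  have /near_in_itvoo : x \in `]a, b[ by rewrite in_itv /= ax.
  apply: filterS => y; rewrite in_itv /= => /andP[ay yb].
  apply: eq_Rintegral => z; rewrite inE /= in_itv /= => /andP[az zy].
  by rewrite /f' patchE mem_set //= in_itv /= az (le_trans zy) // ltW.
split; first exact: near_eq_derivable H1.
rewrite -(near_eq_derive _ E) -derive1E H2 /f' patchE mem_set //.
by rewrite /= in_itv /= !ltW.
Qed.

(** The density is the difference of those of the two monotone functions [tv F] and [tv F - F]. *)
Lemma rac_density F : rac a b F -> exists2 f, L1 f &
  forall x, a <= x <= b -> F x = F a + prim f x.
Proof.
move=> HF; have HV := rac_tv hab HF; have HW := racB HV HF.
have [|g gi gP] := monotone_rac_density hab HV.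
  move=> x y ax xy yb; rewrite -subr_ge0; apply: le_trans (norm_le_tv hab HF ax xy yb).
  exact: normr_ge0.
have [|h hi hP] := monotone_rac_density hab HW.
  move=> x y ax xy yb; have := norm_le_tv hab HF ax xy yb.
  by have := ler_norm (F y - F x); lra.
have g1 : L1 g by apply: integrableS gi.
have h1 : L1 h by apply: integrableS hi.
exists (fun x => g x - h x); first exact: L1B.
move=> x xab; have /andP[_ xb] := xab.
have -> : prim (fun t => g t - h t) x = prim g x - prim h x.
  by rewrite /prim RintegralB //; exact: L1S_itv.
have := gP x xab; have := hP x xab; rewrite -/(prim _ _) -/(prim _ _); lra.
Qed.

Lemma rac_derivable F : rac a b F -> aei a b (fun x => derivable F x 1).
Proof.
move=> /rac_density[f Hf FE]; apply: aeiS (prim_deriv Hf) => x xab dx.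
have h : derivable (fun y => F a + prim f y) x 1.
  by apply: derivableD; [exact: derivable_cst|exact: ex_derive].
apply: near_eq_derivable h.
have /near_in_itvoo : x \in `]a, b[ by rewrite in_itv.
by apply: filterS => y; rewrite in_itv /= => /andP[ay yb]; rewrite (FE y) // (ltW ay) (ltW yb).
Qed.

(** By [prim_deriv] a density of [F] equals the derivative of [F] almost everywhere, hence equals
    [f], and primitives ignore null sets. *)
Lemma rac_FTC F f : rac a b F -> L1 f -> aei a b (fun x => derive1 F x = f x) ->
  forall x, a <= x <= b -> F x = F a + prim f x.
Proof.
move=> /rac_density[g Hg FE] Hf Ff x xab; rewrite FE //; congr (_ + _).
have /andP[_ xb] := xab; apply: prim_ae => //.
apply: aeiS2 (prim_deriv Hg) Ff => y yab dg <-.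
have h : is_derive y 1 (fun y => F a + prim g y) (0 + g y) by apply: is_deriveD.
rewrite derive1E -(@near_eq_derive _ _ _ (fun y => F a + prim g y)).
  by rewrite derive_val add0r.
have /near_in_itvoo : y \in `]a, b[ by rewrite in_itv.
by apply: filterS => z; rewrite in_itv /= => /andP[az zb]; rewrite (FE z) // (ltW az) (ltW zb).
Qed.

End Primitives.

(** * Linear systems with integrable coefficients *)

Section Caratheodory.
Context {R : realType}.
Variables (a b : R).
Hypothesis hab : a < b.
Local Notation mu := (@lebesgue_measure R).
Local Notation L1 := (L1 a b).
Local Notation prim := (prim a).

(** With [r n] the tail of the geometric series, [u n - r n] increases, [u n + r n] decreases, and
    the first stays below the second. The supremum of the first is therefore the limit, with an
    explicit rate. *)
Lemma geometric_limit (u : nat -> R) (C : R) :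
  (forall n, `|u n.+1 - u n| <= C / 2 ^+ n) ->
  exists l, forall n, `|u n - l| <= 2 * C / 2 ^+ n.
Proof.
move=> H; pose r n : R := 2 * C / 2 ^+ n.
have rS n : r n - r n.+1 = C / 2 ^+ n.
  have h : 2 ^+ n != 0 :> R by rewrite expf_neq0.
  by rewrite /r exprS; field.
have C0 : 0 <= C by have := H 0%N; rewrite expr0 divr1; apply: le_trans.
have r0 n : 0 <= r n by rewrite /r !mulr_ge0 ?invr_ge0 ?exprn_ge0.
pose v n := u n - r n; pose w n := u n + r n.
have vS n : v n <= v n.+1.
  by have := H n; rewrite /v -rS ler_norml => /andP[]; lra.
have wS n : w n.+1 <= w n.
  by have := H n; rewrite /w -rS ler_norml => /andP[]; lra.
have vnd : {homo v : i j / (i <= j)%N >-> i <= j}.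
  by apply: homo_leq => //; exact: le_trans.
have wni : {homo w : i j / (i <= j)%N >-> j <= i}.
  by apply: homo_leq => // y x z xy yz; exact: le_trans yz xy.
have vw m n : v m <= w n.
  apply: (le_trans (vnd _ _ (leq_maxl m n))); apply: le_trans (wni _ _ (leq_maxr m n)).
  by rewrite /v /w; have := r0 (maxn m n); lra.
have hs : has_sup (range v).
  by split; [exists (v 0%N); exists 0%N|exists (w 0%N) => _ [m _ <-]].
exists (sup (range v)) => n.
have h1 : v n <= sup (range v) by apply: ub_le_sup; [exact: hs.2|exists n].
have h2 : sup (range v) <= w n by apply: ge_sup; [exact: hs.1|move=> _ [m _ <-]].
by rewrite ler_norml -/(r n); move: h1 h2; rewrite /v /w; lra.
Qed.

Lemma small_of_geometric (x C : R) : (forall n, `|x| <= C / 2 ^+ n) -> x = 0.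
Proof.
move=> H; apply/eqP; apply: contraT => x0.
have C0 : 0 <= C by have := H 0%N; rewrite expr0 divr1; apply: le_trans.
have h : 0 <= C / `|x| by rewrite divr_ge0.
pose n := Num.bound (C / `|x|).
have h1 : C / `|x| < 2 ^+ n.
  by apply: lt_le_trans (archi_boundP h) _; rewrite -natrX ler_nat ltnW // ltn_expl.
have := H n; rewrite ler_pdivlMr ?exprn_gt0 //.
by rewrite ltr_pdivrMr ?normr_gt0 // mulrC in h1; rewrite leNgt h1.
Qed.

Lemma cvg_geometric_dist (u : nat -> R) (l C : R) :
  (forall n, `|u n - l| <= C / 2 ^+ n) -> u n @[n --> \oo] --> l.
Proof.
move=> H; apply/(@cvgrPdist_le _ R^o) => e e0.
have C0 : 0 <= C by have := H 0%N; rewrite expr0 divr1; apply: le_trans.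
have h : 0 <= C / e by rewrite divr_ge0 // ltW.
exists (Num.bound (C / e)) => // n /= Nn; rewrite distrC (le_trans (H n)) //.
rewrite ler_pdivrMr ?exprn_gt0 // mulrC -ler_pdivrMr //.
apply: (le_trans (ltW (archi_boundP h))).
by rewrite -natrX ler_nat (leq_trans Nn) // ltnW // ltn_expl.
Qed.

Lemma prim_norm_le (f g : R -> R) x : x <= b -> L1 f -> L1 g ->
  (forall t, a <= t <= b -> `|f t| <= g t) -> `|prim f x| <= prim g x.
Proof.
move=> xb Hf Hg fg; apply: (le_trans (le_normr_Rintegral _ (L1S_itv xb Hf))) => //.
apply: le_Rintegral => //; [exact: (L1S_itv xb (L1_norm Hf))|exact: (L1S_itv xb Hg)|].
move=> t; rewrite /= in_itv /= => /andP[ta tx]; apply: fg.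
by rewrite ta (le_trans tx).
Qed.

Lemma prim_le (f : R -> R) x y : L1 f -> (forall t, a <= t <= b -> 0 <= f t) ->
  a <= x -> x <= y -> y <= b -> prim f x <= prim f y.
Proof.
move=> Hf f0 ax xy yb; rewrite -subr_ge0 (primB Hf) //.
apply: Rintegral_ge0 => t; rewrite /= in_itv /= => /andP[xt ty].
by apply: f0; rewrite (le_trans ax (ltW xt)) (le_trans ty).
Qed.

Lemma prim_eq (f g : R -> R) x : x <= b -> (forall t, a <= t <= b -> f t = g t) ->
  prim f x = prim g x.
Proof.
move=> xb fg; apply: eq_Rintegral => t; rewrite inE /= in_itv /= => /andP[ta tx].
by rewrite fg // ta (le_trans tx).
Qed.

Lemma primZ c (f : R -> R) x : x <= b -> L1 f -> prim (fun t => c * f t) x = c * prim f x.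
Proof. by move=> xb Hf; rewrite /prim RintegralZl //; exact: (L1S_itv xb Hf). Qed.

Lemma primsub (f g : R -> R) x : x <= b -> L1 f -> L1 g ->
  prim (fun t => f t - g t) x = prim f x - prim g x.
Proof.
move=> xb Hf Hg.
by rewrite /prim RintegralB //; [exact: (L1S_itv xb Hf)|exact: (L1S_itv xb Hg)].
Qed.

(** The integral of [k] against the weight is less than half the weight: this is the contraction
    constant of the Picard map. As [prim k] is only absolutely continuous, the antiderivative is
    justified by [rac_FTC]. *)
Lemma prim_expR (k : R -> R) x : L1 k -> a <= x <= b ->
  prim (fun t => k t * expR (2 * prim k t)) x = (expR (2 * prim k x) - 1) / 2.
Proof.
move=> Hk xab; have /andP[_ xb] := xab.
have HK : rac a b (fun t => 2 * prim k t) by apply: racZ; exact: prim_rac.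
have HE : rac a b (expR \o (fun t => 2 * prim k t)) by exact: rac_expR.
have HkE : L1 (fun t => k t * expR (2 * prim k t)) by exact: (L1M hab HE).
suff D : aei a b (fun t => derive1 (expR \o (fun t => 2 * prim k t)) t =
    2 * (k t * expR (2 * prim k t))).
  have := rac_FTC hab HE (L1Z 2 HkE) D xab.
  by rewrite primZ // /= prim_a mulr0 expR0 => ->; field.
apply: aeiS (prim_deriv Hk) => t tab dt.
have d2 : is_derive t 1 (fun t => 2 * prim k t) (2 * k t).
  have := @is_deriveZ _ _ _ (prim k) 2 t 1 (k t) dt.
  by [].
have := @is_derive1_comp _ expR (fun t => 2 * prim k t) t _ _ (is_derive_expR _) d2.
by move=> dE; rewrite derive1E derive_val; ring.
Qed.

Variables (I : finType) (M : I -> I -> R -> R) (F : I -> R -> R) (c : I -> R).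
Hypothesis HM : forall i j, L1 (M i j).
Hypothesis HF : forall i, L1 (F i).

Let rhs (Y : I -> R -> R) i t := \sum_j M i j t * Y j t + F i t.
Let step (Y : I -> R -> R) i x := c i + prim (rhs Y i) x.

Let L1_rhs (Y : I -> R -> R) i K : (forall j, measurable_fun `[a, b] (Y j)) ->
  (forall j x, a <= x <= b -> `|Y j x| <= K) -> L1 (rhs Y i).
Proof.
move=> mY YK; apply: L1D (HF i); apply: L1_sum => j.
exact: L1Mb (mY j) (YK j) (HM i j).
Qed.

Let L1_rhs_rac (Y : I -> R -> R) i : (forall j, rac a b (Y j)) -> L1 (rhs Y i).
Proof.
move=> HY; apply: L1D (HF i); apply: L1_sum => j.
exact: L1M.
Qed.

Let rac_step Y i : L1 (rhs Y i) -> rac a b (step Y i).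
Proof. by move=> H; apply: racD; [exact: rac_cst|exact: prim_rac]. Qed.

Let k t := \sum_i \sum_j `|M i j t|.

Let L1_k : L1 k.
Proof. by apply: L1_sum => i; apply: L1_sum => j; exact: L1_norm. Qed.

Let k_ge0 t : 0 <= k t.
Proof. by apply: sumr_ge0 => i _; apply: sumr_ge0. Qed.

Let rhs_diff Y Z i t (B : R) : (forall j, `|Y j t - Z j t| <= B) ->
  `|rhs Y i t - rhs Z i t| <= k t * B.
Proof.
move=> H; rewrite /rhs opprD addrACA subrr addr0 -sumrB.
apply: (le_trans (ler_norm_sum _ _ _)).
apply: (@le_trans _ _ ((\sum_j `|M i j t|) * B)).
  rewrite mulr_suml; apply: ler_sum => j _; rewrite -mulrBr normrM.
  by rewrite ler_wpM2l.
apply: ler_wpM2r.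
  (* The bound [B] is nonnegative because the index type contains [i], hence some [j] to which the
     hypothesis applies. *)
  have [j|I0] := pickP [pred _ : I | true]; first by move=> _; apply: le_trans (H j).
  by have := I0 i.
rewrite /k [X in _ <= X](bigD1 i) //= lerDl; apply: sumr_ge0 => j _; exact: sumr_ge0.
Qed.

Let Yn n := iter n step (fun i _ => c i).

Let rac_Yn n i : rac a b (Yn n i).
Proof.
elim: n i => [|n IH] i; first exact: rac_cst.
by apply: rac_step; exact: L1_rhs_rac.
Qed.

Let E x := expR (2 * prim k x).

Let rac_E : rac a b E.
Proof. by apply: rac_expR => //; apply: racZ; exact: prim_rac. Qed.

Lemma caratheodory : exists Y : I -> R -> R,
  (forall i, rac a b (Y i)) /\
  forall i, L1 (fun t => \sum_j M i j t * Y j t + F i t) /\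
  forall x, a <= x <= b ->
    Y i x = c i + prim (fun t => \sum_j M i j t * Y j t + F i t) x.
Proof.
have K0 x : a <= x -> x <= b -> 0 <= prim k x.
  move=> ax xb; rewrite -(prim_a a k); apply: prim_le => //; exact: lexx.
have E1 x : a <= x <= b -> 1 <= E x.
  by case/andP => ax xb; rewrite /E -expR0 ler_expR mulr_ge0 // K0.
have [B0 B0P] : exists B0 : I -> R, forall i x, a <= x <= b -> `|Yn 1 i x - Yn 0 i x| <= B0 i.
  have H i : exists B0, forall x, a <= x <= b -> `|Yn 1 i x - Yn 0 i x| <= B0.
    by have [B0 _ h] := rac_bounded hab (racB (rac_Yn 1 i) (rac_Yn 0 i)); exists B0.
  by have [B0 h] := choice H; exists B0.
pose B := \sum_i `|B0 i|.
have BP i x : a <= x <= b -> `|Yn 1 i x - Yn 0 i x| <= B.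
  move=> /(B0P i) h; apply: (le_trans h); apply: (le_trans (ler_norm _)).
  by rewrite /B (bigD1 i) //= lerDl sumr_ge0.
have B0' : 0 <= B by apply: sumr_ge0.
(* The weight [E = exp (2 K)], with [K] a primitive of the norm [k] of the system, makes
   the Picard map a contraction of ratio 1/2 on the whole interval. *)
have main n i x : a <= x <= b -> `|Yn n.+1 i x - Yn n i x| <= B / 2 ^+ n * E x.
  elim: n i x => [|n IH] i x xab.
    rewrite expr0 divr1; apply: (le_trans (BP i x xab)).
    by rewrite ler_peMr // E1.
  have /andP[ax xb] := xab.
  rewrite [Yn n.+2]/= [Yn n.+1]/= -/(Yn n) /step opprD addrACA subrr add0r.
  rewrite -primsub //; [|exact: (L1_rhs_rac _ (rac_Yn n.+1))|exact: L1_rhs_rac].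
  have L1kE : L1 (fun t => k t * E t) by exact: L1M.
  apply: (@le_trans _ _ (prim (fun t => B / 2 ^+ n * (k t * E t)) x)).
    apply: prim_norm_le => //.
    - by apply: L1B; [exact: (L1_rhs_rac _ (rac_Yn n.+1))|exact: L1_rhs_rac].
    - exact: L1Z.
    - move=> t tab; rewrite mulrCA; apply: rhs_diff => j.
      exact: IH.
  rewrite primZ // /E prim_expR // -/(E x).
  have -> : B / 2 ^+ n.+1 * E x = B / 2 ^+ n * (E x / 2).
    by rewrite exprS invfM; ring.
  apply: ler_wpM2l; first by rewrite divr_ge0 // exprn_ge0.
  by lra.
have [e e0 eP] := rac_bounded hab rac_E.
have geo n i x : a <= x <= b -> `|Yn n.+1 i x - Yn n i x| <= B * e / 2 ^+ n.
  move=> xab; apply: (le_trans (main n i x xab)); rewrite mulrAC.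
  apply: ler_wpM2r; first by rewrite invr_ge0 exprn_ge0.
  by apply: ler_wpM2l => //; apply: le_trans (eP _ xab); exact: ler_norm.
have lim i x : exists l, a <= x <= b -> forall n, `|Yn n i x - l| <= 2 * (B * e) / 2 ^+ n.
  have [xab|xab] := boolP (a <= x <= b); last by exists 0.
  have [l lP] := geometric_limit (fun n => geo n i x xab).
  by exists l.
have [Y YP] := choice (fun p : I * R => lim p.1 p.2).
pose C := 2 * (B * e).
have {}YP i x n : a <= x <= b -> `|Yn n i x - Y (i, x)| <= C / 2 ^+ n.
  by move=> xab; exact: (YP (i, x) xab n).
pose Z i x := Y (i, x).
have C0 : 0 <= C.
  by rewrite !mulr_ge0.
(* At this point the limit [Z] is known to be measurable and, below, bounded; this already makes
   [rhs Z] integrable, so that [step Z] is meaningful. *)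
have mZ i : measurable_fun `[a, b] (Z i).
  apply: (@measurable_fun_cvg _ _ _ _ (fun n => Yn n i)) => //.
    by move=> n; exact: rac_measurable.
  move=> x; rewrite /= in_itv /= => xab.
  by apply: (@cvg_geometric_dist _ _ C) => n; exact: YP.
have [K KP] : exists K, forall i x, a <= x <= b -> `|Z i x| <= K.
  exists (\sum_i `|c i| + C) => i x xab.
  have := YP i x 0%N xab; rewrite /Yn /= expr0 divr1 -/(Z i x) => h.
  have -> : Z i x = c i - (c i - Z i x) by ring.
  apply: (le_trans (ler_normB _ _)); apply: lerD => //.
  by rewrite (bigD1 i) //= lerDl sumr_ge0.
have L1Z' i : L1 (rhs Z i) by exact: L1_rhs KP.
(* Both [Z] and [step Z] are within a constant times 2^-n of the iterate [Yn n.+1], for every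
   [n]. *)
have fix_ i x : a <= x <= b -> Z i x = step Z i x.
  move=> xab; have /andP[ax xb] := xab; apply/eqP; rewrite -subr_eq0; apply/eqP.
  apply: (@small_of_geometric _ (C + C * prim k x)) => n.
  have h1 := YP i x n.+1 xab.
  have h2 : `|Yn n.+1 i x - step Z i x| <= C * prim k x / 2 ^+ n.
    rewrite /= -/(Yn n) /step opprD addrACA subrr add0r -primsub //; last exact: L1_rhs_rac.
    rewrite mulrAC -primZ //; apply: prim_norm_le => //.
    - by apply: L1B => //; exact: L1_rhs_rac.
    - exact: L1Z.
    - by move=> t tab; rewrite mulrC; apply: rhs_diff => j; exact: YP.
  have -> : Z i x - step Z i x = (Yn n.+1 i x - step Z i x) - (Yn n.+1 i x - Z i x) by ring.
  apply: (le_trans (ler_normB _ _)); rewrite mulrDl addrC; apply: lerD => //.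
  apply: (le_trans h1); apply: ler_wpM2l => //.
  by rewrite lef_pV2 ?posrE ?exprn_gt0 // exprS ler_peMl ?exprn_ge0 // ler1n.
have eqr i t : a <= t <= b -> rhs Z i t = rhs (step Z) i t.
  by move=> tab; rewrite /rhs; congr (_ + _); apply: eq_bigr => j _; rewrite fix_.
(* The witness is [step Z], not [Z]: being a primitive it is absolutely continuous, and it agrees
   with [Z] on [a, b]. *)
exists (step Z); split; first by move=> i; exact: rac_step.
move=> i; split; first by apply: L1_rhs_rac => j; exact: rac_step.
move=> x /andP[_ xb]; rewrite {1}/step; congr (_ + _).
by apply: prim_eq => // t; exact: eqr.
Qed.

End Caratheodory.

(** * Complex-valued functions *)

Section ComplexParts.
Context {R : realType}.
Implicit Types (z w : R[i]).
Local Notation Re := (@complex.Re R).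
Local Notation Im := (@complex.Im R).

Lemma complex_ext z w : Re z = Re w -> Im z = Im w -> z = w.
Proof. by case: z w => [x y] [u v] /= -> ->. Qed.

Lemma Re_add z w : Re (z + w) = Re z + Re w. Proof. by case: z w => [? ?] []. Qed.
Lemma Im_add z w : Im (z + w) = Im z + Im w. Proof. by case: z w => [? ?] []. Qed.
Lemma Re_opp z : Re (- z) = - Re z. Proof. by case: z. Qed.
Lemma Im_opp z : Im (- z) = - Im z. Proof. by case: z. Qed.
Lemma Re_mul z w : Re (z * w) = Re z * Re w - Im z * Im w.
Proof. by case: z w => [? ?] []. Qed.
Lemma Im_mul z w : Im (z * w) = Re z * Im w + Im z * Re w.
Proof. by case: z w => [? ?] []. Qed.
Lemma Re_conj z : Re z^* = Re z. Proof. by case: z. Qed.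
Lemma Im_conj z : Im z^* = - Im z. Proof. by case: z. Qed.

Definition complexpE := (Re_add, Im_add, Re_opp, Im_opp, Re_mul, Im_mul, Re_conj, Im_conj).

Lemma Re_sum (I : finType) (F : I -> R[i]) : Re (\sum_i F i) = \sum_i Re (F i).
Proof. by elim/big_rec2: _ => [//|i x y _ <-]; rewrite Re_add. Qed.
Lemma Im_sum (I : finType) (F : I -> R[i]) : Im (\sum_i F i) = \sum_i Im (F i).
Proof. by elim/big_rec2: _ => [//|i x y _ <-]; rewrite Im_add. Qed.

Lemma Re_norm z : Re `|z| = Num.sqrt (Re z ^+ 2 + Im z ^+ 2).
Proof. by case: z. Qed.

Lemma Im_norm z : Im `|z| = 0.
Proof. by case: z. Qed.

Lemma norm_Re z : `|z| = ((Re `|z|)%:C)%C.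
Proof. by apply: complex_ext => //=; rewrite Im_norm. Qed.

Lemma Re_norm_sqr z : (Re `|z|) ^+ 2 = Re z ^+ 2 + Im z ^+ 2.
Proof. by rewrite Re_norm sqr_sqrtr // addr_ge0 ?sqr_ge0. Qed.

Lemma Re_norm_ge0 z : 0 <= Re `|z|.
Proof. by rewrite Re_norm sqrtr_ge0. Qed.

Lemma le_Re_norm z : `|Re z| <= Re `|z|.
Proof.
rewrite -ler_sqr ?nnegrE ?Re_norm_ge0 // Re_norm_sqr real_normK ?num_real //.
by rewrite lerDl sqr_ge0.
Qed.

Lemma le_Im_norm z : `|Im z| <= Re `|z|.
Proof.
rewrite -ler_sqr ?nnegrE ?Re_norm_ge0 // Re_norm_sqr real_normK ?num_real //.
by rewrite lerDr sqr_ge0.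
Qed.

Lemma Re_norm_le z : Re `|z| <= `|Re z| + `|Im z|.
Proof.
rewrite -ler_sqr ?nnegrE ?Re_norm_ge0 ?addr_ge0 // Re_norm_sqr sqrrD.
rewrite !real_normK ?num_real // lerD2r lerDl.
by rewrite mulrn_wge0 // mulr_ge0.
Qed.

End ComplexParts.

Section ComplexCalculus.
Context {R : realType}.
Variables (a b : R).
Hypothesis hab : a < b.
Local Notation C := R[i].
Local Notation mu := (@lebesgue_measure R).
Local Notation Re := (@complex.Re R).
Local Notation Im := (@complex.Im R).
Local Notation aei := (aei a b).
Implicit Types (f g : R -> C).

(** Since |Re z| and |Im z| are at most |z|, and |z| at most |Re z| + |Im z|, the real theory
    transfers to complex functions part by part. *)
Lemma abs_cont_rac f : abs_cont a b f <-> rac a b (Re \o f) /\ rac a b (Im \o f).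
Proof.
have S (I : finType) (z : I -> C) : \sum_i `|z i| = ((\sum_i Re `|z i|)%:C)%C.
  by rewrite rmorph_sum; apply: eq_bigr => i _; exact: norm_Re.
split=> [H|[H1 H2]].
  have K (p : C -> R) : (forall z w, p (z - w) = p z - p w) ->
      (forall z, `|p z| <= Re `|z|) -> rac a b (p \o f).
    move=> pB pn; apply: rac_ord => e /H[d d0 {}H]; exists d => // n s t [st1 st2] std.
    have := H n s t st1 st2 std; rewrite S ltcR; apply: le_lt_trans.
    by apply: ler_sum => i _; rewrite /= -pB.
  split; apply: K => [z w|z]; rewrite ?complexpE //; [exact: le_Re_norm|exact: le_Im_norm].
move=> e e0; have e2 : 0 < e / 2 by rewrite divr_gt0.
have [d1 d10 {}H1] := H1 _ e2; have [d2 d20 {}H2] := H2 _ e2.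
exists (Num.min d1 d2); first by rewrite lt_min d10 d20.
move=> n s t st1 st2; rewrite lt_min => /andP[].
move=> /(H1 _ _ _ (conj st1 st2)) A1 /(H2 _ _ _ (conj st1 st2)) A2.
rewrite S ltcR (splitr e); apply: le_lt_trans (ltrD A1 A2).
rewrite -big_split /=; apply: ler_sum => i _.
by apply: (le_trans (Re_norm_le _)); rewrite !complexpE.
Qed.

Lemma abs_contD f g : abs_cont a b f -> abs_cont a b g -> abs_cont a b (fun x => f x + g x).
Proof.
move=> /abs_cont_rac[f1 f2] /abs_cont_rac[g1 g2]; apply/abs_cont_rac; split.
  by apply: rac_eq (racD f1 g1) => x _; rewrite /= complexpE.
by apply: rac_eq (racD f2 g2) => x _; rewrite /= complexpE.
Qed.

Lemma abs_contM f g : abs_cont a b f -> abs_cont a b g -> abs_cont a b (fun x => f x * g x).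
Proof.
move=> /abs_cont_rac[f1 f2] /abs_cont_rac[g1 g2]; apply/abs_cont_rac; split.
  by apply: rac_eq (racB (racM hab f1 g1) (racM hab f2 g2)) => x _; rewrite /= complexpE.
by apply: rac_eq (racD (racM hab f1 g2) (racM hab f2 g1)) => x _; rewrite /= complexpE.
Qed.

Lemma abs_cont_conj f : abs_cont a b f -> abs_cont a b (fun x => (f x)^*).
Proof.
move=> /abs_cont_rac[f1 f2]; apply/abs_cont_rac; split.
  by apply: rac_eq f1 => x _; rewrite /= complexpE.
by apply: rac_eq (racN f2) => x _; rewrite /= complexpE.
Qed.

Lemma abs_cont_cst (c : C) : abs_cont a b (fun=> c).
Proof. by apply/abs_cont_rac; split; apply: rac_cst. Qed.

Lemma abs_contZ c f : abs_cont a b f -> abs_cont a b (fun x => c * f x).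
Proof. by apply: abs_contM; exact: abs_cont_cst. Qed.

Lemma abs_cont_sum (I : finType) (F : I -> R -> C) :
  (forall i, abs_cont a b (F i)) -> abs_cont a b (fun x => \sum_i F i x).
Proof.
move=> H; apply/abs_cont_rac; split.
  apply: (@rac_eq _ _ _ (fun x => \sum_i Re (F i x))) => [x _|]; first by rewrite /= Re_sum.
  by apply: rac_sum => i; have /abs_cont_rac[] := H i.
apply: (@rac_eq _ _ _ (fun x => \sum_i Im (F i x))) => [x _|]; first by rewrite /= Im_sum.
by apply: rac_sum => i; have /abs_cont_rac[] := H i.
Qed.

Definition cderivable f x :=
  derivable (fun t => Re (f t)) x 1 /\ derivable (fun t => Im (f t)) x 1.

Lemma abs_cont_cderivable f : abs_cont a b f -> aei (cderivable f).
Proof. by move=> /abs_cont_rac[f1 f2]; apply: aei_and; exact: rac_derivable. Qed.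

Lemma derive1_add (F G : R -> R) x : derivable F x 1 -> derivable G x 1 ->
  derive1 (fun t => F t + G t) x = derive1 F x + derive1 G x.
Proof. by move=> dF dG; rewrite !derive1E; exact: (deriveD dF dG). Qed.

Lemma derive1_opp (F : R -> R) x : derivable F x 1 ->
  derive1 (fun t => - F t) x = - derive1 F x.
Proof. by move=> dF; rewrite !derive1E; exact: (deriveN dF). Qed.

Lemma derive1_mul (F G : R -> R) x : derivable F x 1 -> derivable G x 1 ->
  derive1 (fun t => F t * G t) x = F x * derive1 G x + G x * derive1 F x.
Proof. by move=> dF dG; rewrite !derive1E; exact: (deriveM dF dG). Qed.

Lemma derivable_add (F G : R -> R) x : derivable F x 1 -> derivable G x 1 ->
  derivable (fun t => F t + G t) x 1.
Proof. by move=> dF dG; exact: (derivableD dF dG). Qed.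

Lemma derivable_opp (F : R -> R) x : derivable F x 1 -> derivable (fun t => - F t) x 1.
Proof. by move=> dF; exact: (derivableN dF). Qed.

Lemma derivable_mul (F G : R -> R) x : derivable F x 1 -> derivable G x 1 ->
  derivable (fun t => F t * G t) x 1.
Proof. by move=> dF dG; exact: (derivableM dF dG). Qed.

Lemma Re_cderive f x : Re (cderive f x) = derive1 (fun t => Re (f t)) x.
Proof. by []. Qed.

Lemma Im_cderive f x : Im (cderive f x) = derive1 (fun t => Im (f t)) x.
Proof. by []. Qed.

Lemma cderiveD f g x : cderivable f x -> cderivable g x ->
  cderive (fun t => f t + g t) x = cderive f x + cderive g x.
Proof.
move=> [f1 f2] [g1 g2]; apply: complex_ext; rewrite complexpE ?Re_cderive ?Im_cderive.
  rewrite -(derive1_add f1 g1); congr (derive1 _ x).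
  by apply/funext => t; rewrite Re_add.
rewrite -(derive1_add f2 g2); congr (derive1 _ x).
by apply/funext => t; rewrite Im_add.
Qed.

Lemma cderiveM f g x : cderivable f x -> cderivable g x ->
  cderive (fun t => f t * g t) x = cderive f x * g x + f x * cderive g x.
Proof.
move=> [f1 f2] [g1 g2]; apply: complex_ext; rewrite !complexpE ?Re_cderive ?Im_cderive.
  have d1 := derivable_mul f1 g1; have d2 := derivable_mul f2 g2.
  have := derive1_add d1 (derivable_opp d2).
  rewrite (derive1_opp d2) (derive1_mul f1 g1) (derive1_mul f2 g2) => E.
  transitivity (derive1 (fun t => Re (f t) * Re (g t) + - (Im (f t) * Im (g t))) x).
    by congr (derive1 _ x); apply/funext => t; rewrite Re_mul.
  by rewrite E; ring.
have d1 := derivable_mul f1 g2; have d2 := derivable_mul f2 g1.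
have := derive1_add d1 d2.
rewrite (derive1_mul f1 g2) (derive1_mul f2 g1) => E.
transitivity (derive1 (fun t => Re (f t) * Im (g t) + Im (f t) * Re (g t)) x).
  by congr (derive1 _ x); apply/funext => t; rewrite Im_mul.
by rewrite E; ring.
Qed.

Lemma cderive_cst (c : C) x : cderive (fun=> c) x = 0.
Proof. by apply: complex_ext; rewrite /cderive /= derive1_cst. Qed.

Lemma cderivable_cst (c : C) x : cderivable (fun=> c) x.
Proof. by split; exact: derivable_cst. Qed.

Lemma cderiveZ c f x : cderivable f x -> cderive (fun t => c * f t) x = c * cderive f x.
Proof.
move=> df; rewrite (cderiveM (cderivable_cst c x) df) cderive_cst mul0r.
exact: add0r.
Qed.

Lemma cderivableD f g x : cderivable f x -> cderivable g x ->
  cderivable (fun t => f t + g t) x.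
Proof.
move=> [f1 f2] [g1 g2]; split.
  have -> : (fun t => Re (f t + g t)) = (fun t => Re (f t) + Re (g t)).
    by apply/funext => t; rewrite Re_add.
  exact: derivable_add f1 g1.
have -> : (fun t => Im (f t + g t)) = (fun t => Im (f t) + Im (g t)).
  by apply/funext => t; rewrite Im_add.
exact: derivable_add f2 g2.
Qed.

Lemma cderivableM f g x : cderivable f x -> cderivable g x ->
  cderivable (fun t => f t * g t) x.
Proof.
move=> [f1 f2] [g1 g2]; split.
  have -> : (fun t => Re (f t * g t)) = (fun t => Re (f t) * Re (g t) + - (Im (f t) * Im (g t))).
    by apply/funext => t; rewrite Re_mul.
  exact: derivable_add (derivable_mul f1 g1) (derivable_opp (derivable_mul f2 g2)).
have -> : (fun t => Im (f t * g t)) = (fun t => Re (f t) * Im (g t) + Im (f t) * Re (g t)).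
  by apply/funext => t; rewrite Im_mul.
exact: derivable_add (derivable_mul f1 g2) (derivable_mul f2 g1).
Qed.

Lemma cderive_conj f x : cderivable f x -> cderive (fun t => (f t)^*) x = (cderive f x)^*.
Proof.
move=> [f1 f2]; apply: complex_ext; rewrite !complexpE ?Re_cderive ?Im_cderive.
  by congr (derive1 _ x); apply/funext => t; rewrite Re_conj.
rewrite -(derive1_opp f2); congr (derive1 _ x).
by apply/funext => t; rewrite Im_conj.
Qed.

Lemma cderivable_conj f x : cderivable f x -> cderivable (fun t => (f t)^*) x.
Proof.
move=> [f1 f2]; split.
  have -> // : (fun t => Re (f t)^*) = (fun t => Re (f t)).
  by apply/funext => t; rewrite Re_conj.
have -> : (fun t => Im (f t)^*) = (fun t => - Im (f t)).
  by apply/funext => t; rewrite Im_conj.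
exact: derivable_opp.
Qed.

Lemma cderive_eq f g : (forall x, a < x < b -> f x = g x) ->
  forall x, a < x < b -> cderive f x = cderive g x.
Proof.
move=> fg x xab; rewrite /cderive !derive1E.
have E (p : C -> R) : \near x, (p \o f) x = (p \o g) x.
  have /near_in_itvoo : x \in `]a, b[ by rewrite in_itv.
  by apply: filterS => y; rewrite in_itv /= => /fg /= ->.
by congr Complex; apply: near_eq_derive; exact: E.
Qed.

Definition cL1 f := L1 a b (Re \o f) /\ L1 a b (Im \o f).

Lemma cL1D f g : cL1 f -> cL1 g -> cL1 (fun x => f x + g x).
Proof.
move=> [f1 f2] [g1 g2]; split.
  rewrite (_ : _ \o _ = fun x => Re (f x) + Re (g x)); first exact: L1D.
  by apply/funext => x /=; rewrite Re_add.
rewrite (_ : _ \o _ = fun x => Im (f x) + Im (g x)); first exact: L1D.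
by apply/funext => x /=; rewrite Im_add.
Qed.

Lemma cL1_rac_mul f g : abs_cont a b g -> cL1 f -> cL1 (fun x => f x * g x).
Proof.
move=> /abs_cont_rac[g1 g2] [f1 f2]; split.
  rewrite (_ : _ \o _ = fun x => Re (f x) * Re (g x) - Im (f x) * Im (g x)).
    by apply: L1B; [exact: (L1M hab g1 f1)|exact: (L1M hab g2 f2)].
  by apply/funext => x /=; rewrite Re_mul.
rewrite (_ : _ \o _ = fun x => Re (f x) * Im (g x) + Im (f x) * Re (g x)).
  by apply: L1D; [exact: (L1M hab g2 f1)|exact: (L1M hab g1 f2)].
by apply/funext => x /=; rewrite Im_mul.
Qed.

Lemma cL1Z c f : cL1 f -> cL1 (fun x => c * f x).
Proof.
move=> Hf; rewrite (_ : (fun x => _) = fun x => f x * c); last by apply/funext => x; rewrite mulrC.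
by apply: cL1_rac_mul Hf; exact: abs_cont_cst.
Qed.

Lemma cintegralD f g : cL1 f -> cL1 g ->
  cintegral a b (fun x => f x + g x) = cintegral a b f + cintegral a b g.
Proof.
move=> [f1 f2] [g1 g2]; apply: complex_ext; rewrite complexpE /cintegral /=.
  by rewrite -RintegralD //; apply: eq_Rintegral => x _; rewrite Re_add.
by rewrite -RintegralD //; apply: eq_Rintegral => x _; rewrite Im_add.
Qed.

Lemma cintegralZ c f : cL1 f -> cintegral a b (fun x => c * f x) = c * cintegral a b f.
Proof.
move=> [f1 f2].
have E p q (u v : R -> R) : L1 a b u -> L1 a b v -> \int[mu]_(x in `[a, b]) (p * u x + q * v x) =
    p * (\int[mu]_(x in `[a, b]) u x) + q * (\int[mu]_(x in `[a, b]) v x).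
  by move=> Hu Hv; rewrite RintegralD ?RintegralZl //; exact: L1Z.
apply: complex_ext; rewrite complexpE /cintegral /=.
  by rewrite -mulNr -E //; apply: eq_Rintegral => x _; rewrite Re_mul mulNr.
by rewrite -E //; apply: eq_Rintegral => x _; rewrite Im_mul.
Qed.

Lemma cintegral_conj f : cL1 f -> cintegral a b (fun x => (f x)^*) = (cintegral a b f)^*.
Proof.
move=> [f1 f2]; apply: complex_ext; rewrite complexpE /cintegral /=.
  by apply: eq_Rintegral => x _; rewrite Re_conj.
transitivity (\int[mu]_(x in `[a, b]) (-1 * Im (f x))).
  by apply: eq_Rintegral => x _; rewrite Im_conj mulN1r.
by rewrite RintegralZl // mulN1r.
Qed.

Lemma cintegral_ae f g : cL1 f -> cL1 g -> aei (fun x => f x = g x) ->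
  cintegral a b f = cintegral a b g.
Proof.
move=> [f1 f2] [g1 g2] fg; rewrite /cintegral; congr Complex.
  by apply: (prim_ae (lexx b) f1 g1); apply: aeiS fg => x _ /= ->.
by apply: (prim_ae (lexx b) f2 g2); apply: aeiS fg => x _ /= ->.
Qed.

Lemma cFTC f g : abs_cont a b f -> cL1 g -> aei (fun x => cderive f x = g x) ->
  f b - f a = cintegral a b g.
Proof.
move=> /abs_cont_rac[f1 f2] [g1 g2] fg.
have bab : a <= b <= b by rewrite lexx ltW.
apply: complex_ext; rewrite !complexpE /cintegral /=.
  have := rac_FTC hab f1 g1 _ bab; rewrite /= => ->; first by rewrite addrC addKr.
  by apply: aeiS fg => x _ <-.
have := rac_FTC hab f2 g2 _ bab; rewrite /= => ->; first by rewrite addrC addKr.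
by apply: aeiS fg => x _ <-.
Qed.

Lemma aei_ex (P : R -> Prop) u v : aei P -> a <= u -> u < v -> v <= b ->
  exists2 y, u < y < v & P y.
Proof.
move=> [N [mN N0 PN]] au uv vb; apply: contrapT => H.
have : (mu `]u, v[ <= mu N)%E.
  apply: le_measure; rewrite ?inE //.
  move=> y; rewrite /= in_itv /= => /andP[uy yv]; apply: PN => /= HP.
  apply: H; exists y; first by rewrite uy.
  by apply: HP; rewrite (le_lt_trans au uy) (lt_le_trans yv vb).
by rewrite N0 lebesgue_measure_itv /= lte_fin uv -EFinD lee_fin subr_le0 leNgt uv.
Qed.

(** A set of full measure meets every subinterval, and the difference of the two functions is
    uniformly continuous. *)
Lemma abs_cont_ae_eq f g : abs_cont a b f -> abs_cont a b g -> aei (fun x => f x = g x) ->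
  forall x, a <= x <= b -> f x = g x.
Proof.
have real_case (F G : R -> R) : rac a b F -> rac a b G -> aei (fun x => F x = G x) ->
    forall x, a <= x <= b -> F x = G x.
  move=> HF HG FG x /andP[ax xb]; apply/eqP; apply: contraT => FGx.
  have e0 : 0 < `|F x - G x| by rewrite normr_gt0 subr_eq0.
  have [d d0 H] := rac_unif (racB HF HG) e0.
  (* The neighbourhood is cut at [a] and [b] because [x] may be an end point. *)
  pose u := Num.max a (x - d / 2); pose v := Num.min b (x + d / 2).
  have d2 : 0 < d / 2 by rewrite divr_gt0.
  have au : a <= u by rewrite le_max lexx.
  have vb : v <= b by rewrite ge_min lexx.
  have uv : u < v.
    rewrite lt_min !gt_max hab /= ltrBlDr (le_lt_trans xb) ?ltrDl //=.
    by rewrite (le_lt_trans ax) ?ltrDl //= ltrBlDr -addrA ltrDl addr_gt0.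
  have [y /andP[uy yv] FGy] := aei_ex FG au uv vb.
  move: uy yv; rewrite gt_max lt_min => /andP[ay xy] /andP[yb yx].
  case: (leP x y) => xy'.
    have := H x y ax xy' (ltW yb); rewrite FGy subrr sub0r normrN ltxx; apply.
    by lra.
  have := H y x (ltW ay) (ltW xy') xb; rewrite FGy subrr subr0 ltxx; apply.
  by lra.
move=> /abs_cont_rac[f1 f2] /abs_cont_rac[g1 g2] fg x xab.
apply: complex_ext; [apply: (real_case _ _ f1 g1 _ x xab)|apply: (real_case _ _ f2 g2 _ x xab)];
  by apply: aeiS fg => t _ /= ->.
Qed.

End ComplexCalculus.

(** * Square-integrable functions and their inner product *)

Section SquareIntegrable.
Context {R : realType}.
Variables (a b : R).
Hypothesis hab : a < b.
Local Notation C := R[i].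
Local Notation mu := (@lebesgue_measure R).
Local Notation Re := (@complex.Re R).
Local Notation Im := (@complex.Im R).
Local Notation aei := (aei a b).
Local Notation cL1 := (cL1 a b).
Local Notation L2 := (Lp a b 2).
Local Notation ip := (L2_ip a b).
Implicit Types (f g : R -> C).

Lemma Lp1_cL1 f : Lp a b 1 f -> cL1 f.
Proof.
move=> [m1 m2 i1].
have H : L1 a b (fun x => Re `|f x|) by exact: i1.
by split; apply: (L1_le _ _ H) => // x _ /=; [exact: le_Re_norm|exact: le_Im_norm].
Qed.

Lemma Lp2P f : L2 f <-> [/\ measurable_fun `[a, b] (fun x => Re (f x)),
  measurable_fun `[a, b] (fun x => Im (f x)) &
  L1 a b (fun x => Re (f x) ^+ 2 + Im (f x) ^+ 2)].
Proof.
have E : (fun x => (Re `|f x| ^+ 2)%:E) =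
    EFin \o (fun x => Re (f x) ^+ 2 + Im (f x) ^+ 2).
  by apply/funext => x /=; rewrite Re_norm_sqr.
by split=> -[m1 m2 i1]; split => //; [rewrite /L1 -E|rewrite E].
Qed.

Lemma Lp2_dom f (g : R -> R) : measurable_fun `[a, b] (fun x => Re (f x)) ->
  measurable_fun `[a, b] (fun x => Im (f x)) -> L1 a b g ->
  (forall x, a <= x <= b -> Re (f x) ^+ 2 + Im (f x) ^+ 2 <= g x) -> L2 f.
Proof.
move=> m1 m2 Hg fg; apply/Lp2P; split => //; apply: (L1_le _ _ Hg) => [|x /fg h].
  by apply: measurable_funD; apply: measurable_funX.
by rewrite ger0_norm // addr_ge0 ?sqr_ge0.
Qed.

(** The interval is bounded, so 1 is integrable, and |r| is at most 1 + r^2. *)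
Lemma Lp2_cL1 f : L2 f -> cL1 f.
Proof.
move=> /Lp2P[m1 m2 Hf]; have H := L1D (L1_cst hab 1) Hf.
have E (r s : R) : `|r| <= 1 + (r ^+ 2 + s ^+ 2).
  have : 0 <= (`|r| - 1) ^+ 2 by exact: sqr_ge0.
  have : 0 <= s ^+ 2 by exact: sqr_ge0.
  have : 0 <= `|r| by [].
  rewrite sqrrB real_normK ?num_real // expr1n mulr1 mulr2n; lra.
split; apply: (L1_le _ _ H) => [//|x _]; first exact: (E (Re (f x)) (Im (f x))).
by have := E (Im (f x)) (Re (f x)); rewrite [X in 1 + X]addrC.
Qed.

Lemma Lp2D f g : L2 f -> L2 g -> L2 (fun x => f x + g x).
Proof.
move=> /Lp2P[f1 f2 fi] /Lp2P[g1 g2 gi]; apply: (Lp2_dom _ _ (L1Z 2 (L1D fi gi))).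
- have -> : (fun x => Re (f x + g x)) = (fun x => Re (f x)) \+ (fun x => Re (g x)).
    by apply/funext => x; rewrite Re_add.
  exact: measurable_funD.
- have -> : (fun x => Im (f x + g x)) = (fun x => Im (f x)) \+ (fun x => Im (g x)).
    by apply/funext => x; rewrite Im_add.
  exact: measurable_funD.
move=> x _; rewrite !complexpE.
have h1 : 0 <= (Re (f x) - Re (g x)) ^+ 2 by exact: sqr_ge0.
have h2 : 0 <= (Im (f x) - Im (g x)) ^+ 2 by exact: sqr_ge0.
move: h1 h2; set p := Re (f x); set q := Re (g x); set r := Im (f x); set s := Im (g x).
by rewrite !expr2; lra.
Qed.

Lemma Lp2Z c f : L2 f -> L2 (fun x => c * f x).
Proof.
move=> /Lp2P[f1 f2 fi].
apply: (Lp2_dom _ _ (L1Z (Re c ^+ 2 + Im c ^+ 2) fi)).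
- have -> : (fun x => Re (c * f x)) = (fun x => Re c * Re (f x)) \- (fun x => Im c * Im (f x)).
    by apply/funext => x /=; rewrite Re_mul.
  by apply: measurable_funB; apply: measurable_funM.
- have -> : (fun x => Im (c * f x)) = (fun x => Re c * Im (f x)) \+ (fun x => Im c * Re (f x)).
    by apply/funext => x /=; rewrite Im_mul.
  by apply: measurable_funD; apply: measurable_funM.
by move=> x _; rewrite !complexpE le_eqVlt; apply/orP; left; apply/eqP; ring.
Qed.

Lemma Lp2N f : L2 f -> L2 (fun x => - f x).
Proof.
by move=> /(Lp2Z (-1)); rewrite (_ : (fun x => -1 * f x) = (fun x => - f x)) //;
  apply/funext => x; rewrite mulN1r.
Qed.

Lemma Lp2B f g : L2 f -> L2 g -> L2 (fun x => f x - g x).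
Proof. by move=> Hf /Lp2N; exact: Lp2D. Qed.

Lemma Lp2_abs_cont f : abs_cont a b f -> L2 f.
Proof.
move=> /abs_cont_rac[f1 f2].
have m1 := rac_measurable hab f1; have m2 := rac_measurable hab f2.
apply/Lp2P; split => //.
by apply: L1_rac => //; apply: racD; exact: racM.
Qed.

Lemma Lp2_mul f g : L2 f -> L2 g -> cL1 (fun x => f x * (g x)^*).
Proof.
move=> /Lp2P[f1 f2 fi] /Lp2P[g1 g2 gi].
have E (p q r s : R) : `|p * q + r * s| <= (p ^+ 2 + r ^+ 2) + (q ^+ 2 + s ^+ 2).
  have h1 : 0 <= (p - q) ^+ 2 by exact: sqr_ge0.
  have h2 : 0 <= (p + q) ^+ 2 by exact: sqr_ge0.
  have h3 : 0 <= (r - s) ^+ 2 by exact: sqr_ge0.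
  have h4 : 0 <= (r + s) ^+ 2 by exact: sqr_ge0.
  rewrite ler_norml; move: h1 h2 h3 h4; rewrite !expr2 => h1 h2 h3 h4.
  by apply/andP; split; nra.
have H := L1D fi gi; split; apply: (L1_le _ _ H).
- rewrite (_ : _ \o _ = (fun x => Re (f x) * Re (g x)) \+ (fun x => Im (f x) * Im (g x))).
    by apply: measurable_funD; apply: measurable_funM.
  by apply/funext => x /=; rewrite !complexpE; ring.
- by move=> x _ /=; rewrite !complexpE mulrN opprK; exact: E.
- rewrite (_ : _ \o _ = (fun x => Im (f x) * Re (g x)) \- (fun x => Re (f x) * Im (g x))).
    by apply: measurable_funB; apply: measurable_funM.
  by apply/funext => x /=; rewrite !complexpE; ring.
- move=> x _ /=; rewrite !complexpE mulrN addrC -mulNr addrC.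
  rewrite [_ * Im (g x) + _]addrC.
  apply: (le_trans (E _ _ _ _)); rewrite sqrrN; lra.
Qed.

Lemma ip_ae f f' g g' : L2 f -> L2 f' -> L2 g -> L2 g' ->
  aei (fun x => f x = f' x) -> aei (fun x => g x = g' x) -> ip f g = ip f' g'.
Proof.
move=> Hf Hf' Hg Hg' ff gg; apply: cintegral_ae; try exact: Lp2_mul.
by apply: aeiS2 ff gg => x _ -> ->.
Qed.

Lemma ipDl f g h : L2 f -> L2 g -> L2 h ->
  ip (fun x => f x + g x) h = ip f h + ip g h.
Proof.
move=> Hf Hg Hh; rewrite /L2_ip -cintegralD; try exact: Lp2_mul.
by congr cintegral; apply/funext => x; rewrite mulrDl.
Qed.

Lemma ipZl c f h : L2 f -> L2 h -> ip (fun x => c * f x) h = c * ip f h.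
Proof.
move=> Hf Hh; rewrite /L2_ip -cintegralZ; last exact: Lp2_mul.
by congr cintegral; apply/funext => x; rewrite mulrA.
Qed.

Lemma ipC f g : L2 f -> L2 g -> ip g f = (ip f g)^*.
Proof.
move=> Hf Hg; rewrite /L2_ip -cintegral_conj; last exact: Lp2_mul.
by congr cintegral; apply/funext => x; rewrite rmorphM /= conjCK mulrC.
Qed.

Lemma ipZr c f h : L2 f -> L2 h -> ip h (fun x => c * f x) = c^* * ip h f.
Proof.
move=> Hf Hh; rewrite ipC ?ipZl //; last exact: Lp2Z.
by rewrite rmorphM /= -ipC.
Qed.

Lemma ipBl f g h : L2 f -> L2 g -> L2 h ->
  ip (fun x => f x - g x) h = ip f h - ip g h.
Proof.
move=> Hf Hg Hh; have := ipDl Hf (Lp2Z (-1) Hg) Hh.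
rewrite ipZl // mulN1r => <-; congr (ip _ h).
by apply/funext => x; rewrite mulN1r.
Qed.

Lemma ipBr f g h : L2 f -> L2 g -> L2 h ->
  ip h (fun x => f x - g x) = ip h f - ip h g.
Proof.
move=> Hf Hg Hh; rewrite ipC ?ipBl //; last exact: Lp2B.
by rewrite rmorphB /= -!ipC.
Qed.

Lemma Lp2_sum (I : finType) (F : I -> R -> C) :
  (forall i, L2 (F i)) -> L2 (fun x => \sum_i F i x).
Proof.
move=> H; rewrite (_ : (fun x => _) = \sum_i F i); last by apply/funext => x; rewrite fct_sumE.
apply: (big_ind (fun f => L2 f)) => //.
  by apply: Lp2_abs_cont; exact: abs_cont_cst.
by move=> u v; exact: Lp2D.
Qed.

Lemma ip_suml (I : finType) (F : I -> R -> C) h :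
  (forall i, L2 (F i)) -> L2 h -> ip (fun x => \sum_i F i x) h = \sum_i ip (F i) h.
Proof.
move=> H Hh; rewrite (_ : (fun x => _) = \sum_i F i); last by apply/funext => x; rewrite fct_sumE.
suff [] : L2 (\sum_i F i) /\ ip (\sum_i F i) h = \sum_i ip (F i) h by [].
elim/big_rec2: _ => [|i y1 y2 _ [Hy1 <-]].
  have z : L2 (fun=> 0) by apply: Lp2_abs_cont; exact: abs_cont_cst.
  split => //; transitivity (ip (fun x => 0 * (fun=> 0) x) h).
    by congr (ip _ h); apply/funext => x; rewrite mul0r.
  by rewrite ipZl // mul0r.
by split; [exact: Lp2D|exact: ipDl].
Qed.

Lemma ip_eq0 f : L2 f -> ip f f = 0 -> aei (fun x => f x = 0).
Proof.
move=> Hf; have /Lp2P[f1 f2 fi] := Hf.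
move=> /(congr1 Re); rewrite /L2_ip /cintegral /= => H0.
have {}H0 : \int[mu]_(x in `[a, b]) (Re (f x) ^+ 2 + Im (f x) ^+ 2) = 0.
  rewrite -[RHS]H0; apply: eq_Rintegral => x _.
  by rewrite !complexpE; ring.
pose q (x : R) : R := Re (f x) ^+ 2 + Im (f x) ^+ 2.
have fin : (\int[mu]_(x in `[a, b]) (EFin \o q) x)%E \is a fin_num.
  by apply: integrable_fin_num.
have I0 : (\int[mu]_(x in `[a, b]) `|(EFin \o q) x| = 0)%E.
  transitivity (\int[mu]_(x in `[a, b]) (EFin \o q) x)%E.
    by apply: eq_integral => x _ /=; rewrite ger0_norm // addr_ge0 ?sqr_ge0.
  by rewrite -(fineK fin) [X in X%:E]H0.
have ae0 : ae_eq mu `[a, b]%classic (EFin \o q) (cst 0%E).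
  by apply/ae_eq_integral_abs => //; apply: (measurable_int mu); exact: fi.
have /ae_aei : {ae mu, forall x, `[a, b]%classic x -> Re (f x) ^+ 2 + Im (f x) ^+ 2 = 0}.
  by apply: filterS ae0 => x H /H [].
apply: aeiS => x _ /eqP; rewrite paddr_eq0 ?sqr_ge0 // !sqrf_eq0 => /andP[/eqP r0 /eqP i0].
exact: complex_ext.
Qed.

End SquareIntegrable.

(** * The first-order system *)

Section FormalAdjoint.
Context {R : realType}.
Variable p : nat.
Local Notation C := R[i].

Lemma signr_odd_eq (k l : nat) : odd k = odd l -> (-1) ^+ k = (-1) ^+ l :> C.
Proof. by move=> kl; rewrite -[LHS]signr_odd kl signr_odd. Qed.

Lemma rev_ord_parity (i : 'I_p.+1) : odd (rev_ord i) = odd p (+) odd i.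
Proof. by rewrite /= subSS oddB // -ltnS. Qed.

Lemma Lambda_sqr : @Lambda_mx R p.+1 *m @Lambda_mx R p.+1 = (-1) ^+ p *: 1%:M.
Proof.
apply/matrixP => i j; rewrite !mxE (bigD1 (rev_ord i)) //= big1 ?addr0; last first.
  by move=> k ki; rewrite !mxE (negbTE ki) mul0r.
rewrite !mxE eqxx rev_ordK -mulr_natr (eq_sym i j); case: eqVneq => [_|_] /=; last first.
  by rewrite !mulr0.
rewrite !mulr1 -exprD; apply: signr_odd_eq.
by rewrite oddD /= rev_ord_parity; case: (odd p); case: (odd i).
Qed.

Lemma mul_Lambda_scale : @Lambda_mx R p.+1 *m ((-1) ^+ p *: @Lambda_mx R p.+1) = 1%:M.
Proof.
by rewrite -scalemxAr Lambda_sqr scalerA -exprD addnn -mul2n exprM sqrrN expr1n expr1n scale1r.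
Qed.

Lemma Lambda_unit : @Lambda_mx R p.+1 \in unitmx.
Proof. by have [] := mulmx1_unit mul_Lambda_scale. Qed.

Lemma invmx_Lambda : invmx (@Lambda_mx R p.+1) = (-1) ^+ p *: @Lambda_mx R p.+1.
Proof. by rewrite -[RHS](mulKmx Lambda_unit) mul_Lambda_scale mulmx1. Qed.

(** Up to signs, [A^+] is the conjugate of the reflection of [A] in its antidiagonal. The symmetry
    thus relates row k to column m-1-k, which explains the pairing of indices in [bracket]. *)
Lemma formal_adjointE (A : R -> 'M[C]_p.+1) x (i j : 'I_p.+1) :
  formal_adjoint A x i j = (-1) ^+ (i + j).+1 * (A x (rev_ord j) (rev_ord i))^*.
Proof.
rewrite /formal_adjoint invmx_Lambda -!scalemxAl !mxE (bigD1 (rev_ord j)) //=.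
rewrite big1 ?addr0; last first.
  move=> k kj; have /negbTE E : j != rev_ord k.
    by apply: contra kj => /eqP ->; rewrite rev_ordK.
  by rewrite [X in _ * X]mxE E mulr0.
rewrite !mxE (bigD1 (rev_ord i)) //= big1 ?addr0; last first.
  by move=> k ki; rewrite !mxE (negbTE ki) mul0r.
rewrite !mxE rev_ordK !eqxx.
set z := _^*; set k := (_ - _).+1.
rewrite [_ * z * _]mulrAC mulrA -!exprD -mulNr; congr (_ * z).
rewrite -mulN1r -exprS; apply: signr_odd_eq.
rewrite /k /= !oddD /= subSS oddB; last by rewrite -ltnS.
by case: (odd p); case: (odd i); case: (odd j).
Qed.

(** The Lagrange bracket; with row and column vectors it reads - u^T [Lambda_mx] conj(v). *)
Definition bracket (u v : 'I_p.+1 -> C) : C :=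
  \sum_(k < p.+1) (-1) ^+ k * (u k * (v (rev_ord k))^*).

Lemma bracketBl u1 u2 v :
  bracket (fun k => u1 k - u2 k) v = bracket u1 v - bracket u2 v.
Proof. by rewrite /bracket -sumrB; apply: eq_bigr => k _; ring. Qed.

(** The terms containing [N] cancel by symmetry. What remains are the inhomogeneous terms: [h] sits
    in the last row and meets the conjugate of [v ord0] with sign (-1)^p, [g] meets [u ord0] with
    sign 1. *)
Lemma bracket_derivative (N : 'M[C]_p.+1) (u v : 'I_p.+1 -> C) (h g : C) :
  (forall i j, N i j = (-1) ^+ (i + j).+1 * (N (rev_ord j) (rev_ord i))^*) ->
  let u' i := \sum_j N i j * u j + (if i == ord_max then h else 0) in
  let v' i := \sum_j N i j * v j + (if i == ord_max then g else 0) in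
  bracket u' v + bracket u v' = (-1) ^+ p * h * (v ord0)^* + u ord0 * g^*.
Proof.
move=> HN u' v'.
have rmax : rev_ord ord_max = ord0 :> 'I_p.+1 by apply/val_inj; rewrite /= subnn.
have r0 : rev_ord ord0 = ord_max :> 'I_p.+1 by apply/val_inj; rewrite /= subn1.
pose S := \sum_(k < p.+1) \sum_(j < p.+1)
  (-1) ^+ k * (N k j * u j * (v (rev_ord k))^*).
have -> : bracket u' v = S + (-1) ^+ p * h * (v ord0)^*.
  rewrite /bracket /u'; under eq_bigr do rewrite mulrDl mulrDr mulr_suml mulr_sumr.
  rewrite big_split /=; congr (_ + _).
  rewrite (bigD1 ord_max) //= eqxx rmax big1 ?addr0 ?mulrA // => k kp.
  by rewrite (negbTE kp) mul0r mulr0.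
have -> : bracket u v' = - S + u ord0 * g^*.
  rewrite /bracket /v'.
  under eq_bigr do rewrite rmorphD /= mulrDr mulrDr rmorph_sum mulr_sumr mulr_sumr.
  rewrite big_split /=; congr (_ + _).
    (* Exchanging the two sums and reflecting one index brings the term with [v'] to the shape of
       [S], where the symmetry of [N] supplies the minus sign. *)
    rewrite exchange_big /= (reindex_inj rev_ord_inj) /= /S -sumrN.
    apply: eq_bigr => k _; rewrite -sumrN; apply: eq_bigr => j _.
    rewrite rmorphM /= (HN k j); set w := (v _)^*; set z := (N _ _)^*.
    have e : (-1) ^+ k * (-1) ^+ k = 1 :> C.
      by rewrite -exprD addnn -mul2n exprM sqrrN expr1n expr1n.
    rewrite exprS exprD; set x := (-1) ^+ k in e *; set y := (-1) ^+ j.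
    by transitivity ((x * x) * y * z * u j * w); [rewrite e; ring|ring].
  rewrite (bigD1 ord0) //= r0 eqxx expr0 mul1r big1 ?addr0 // => k k0.
  case: eqVneq => [E|_]; last by rewrite rmorph0 !mulr0.
  by move: k0; rewrite -(inj_eq rev_ord_inj) E r0 eqxx.
ring.
Qed.

End FormalAdjoint.

(** * Existence and uniqueness for the system *)

Section LinearSystem.
Context {R : realType}.
Variables (a b : R).
Hypothesis hab : a < b.
Variables (p : nat) (A : R -> 'M[R[i]]_p.+1).
Hypothesis hA : shin_zettl a b A.
Local Notation C := R[i].
Local Notation mu := (@lebesgue_measure R).
Local Notation Re := (@complex.Re R).
Local Notation Im := (@complex.Im R).
Local Notation aei := (aei a b).
Local Notation cL1 := (cL1 a b).
Local Notation L2 := (Lp a b 2).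
Local Notation ip := (L2_ip a b).
Implicit Types (u v w : 'I_p.+1 -> R -> C) (h g : R -> C) (c : 'I_p.+1 -> C).

Definition rhs u h (i : 'I_p.+1) (x : R) : C :=
  \sum_j A x i j * u j x + (if i == ord_max then h x else 0).

Definition sol u h : Prop :=
  (forall i, abs_cont a b (u i)) /\
  (forall i, aei (fun x => cderive (u i) x = rhs u h i x)).

(** The entries of [A] are only almost everywhere equal to integrable functions, whereas Picard
    iteration needs integrable ones. *)
Lemma integrable_coefficients : exists B : 'I_p.+1 -> 'I_p.+1 -> R -> C,
  (forall i j, cL1 (B i j)) /\ (forall i j, aei (fun x => A x i j = B i j x)).
Proof.
have [_ H _] := hA.
have H' (q : 'I_p.+1 * 'I_p.+1) : exists g, cL1 g /\ aei (fun x => A x q.1 q.2 = g x).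
  by have [g g1 g2] := H q.1 q.2; exists g; split; [exact: Lp1_cL1|exact: ae_aei].
have [B BP] := choice H'; exists (fun i j => B (i, j)).
by split=> i j; have [? ?] := BP (i, j).
Qed.

Lemma sol_exists h c : cL1 h -> exists u, sol u h /\ forall i, u i a = c i.
Proof.
move=> [h1 h2]; have [B [B1 BA]] := integrable_coefficients.
(* The system is rewritten as a real one of twice the size: the flag [true] marks imaginary parts,
   and each entry becomes the 2 by 2 matrix of multiplication by it. *)
pose M (q r : 'I_p.+1 * bool) t : R :=
  let z := B q.1 r.1 t in
  match q.2, r.2 with
  | false, false => Re z | false, true => - Im z
  | true, false => Im z | true, true => Re z
  end.
pose F (q : 'I_p.+1 * bool) t : R :=
  if q.1 == ord_max then (if q.2 then Im (h t) else Re (h t)) else 0.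
pose c' (q : 'I_p.+1 * bool) : R := if q.2 then Im (c q.1) else Re (c q.1).
have HM q r : L1 a b (M q r).
  case: q r => [i []] [j []]; have [r1 r2] := B1 i j; rewrite /M /=.
  - exact: r1.
  - exact: r2.
  - exact: (L1N r2).
  - exact: r1.
have HF q : L1 a b (F q).
  rewrite /F; case: (q.1 == ord_max); last exact: L1_0.
  by case: q.2; [exact: h2|exact: h1].
have [Y [racY YP]] := caratheodory hab c' HM HF.
pose u (i : 'I_p.+1) x : C := Complex (Y (i, false) x) (Y (i, true) x).
have aa : a <= a <= b by rewrite lexx ltW.
exists u; split; last first.
  move=> i; apply: complex_ext => /=.
    by have [_ ->] := YP (i, false); rewrite // prim_a addr0.
  by have [_ ->] := YP (i, true); rewrite // prim_a addr0.
have acu i : abs_cont a b (u i).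
  by apply/abs_cont_rac; split; [exact: racY (i, false)|exact: racY (i, true)].
split => // i.
have dY q : aei (fun x => derive1 (Y q) x = \sum_r M q r x * Y r x + F q x).
  have [L1q Yq] := YP q.
  apply: aeiS (prim_deriv L1q) => x xab dx.
  have d : is_derive x 1 (fun y => c' q + prim a (fun t => \sum_r M q r t * Y r t + F q t) y)
      (0 + (\sum_r M q r x * Y r x + F q x)) by apply: is_deriveD.
  rewrite derive1E -(@near_eq_derive _ _ _
    (fun y => c' q + prim a (fun t => \sum_r M q r t * Y r t + F q t) y)).
    by rewrite derive_val add0r.
  have /near_in_itvoo : x \in `]a, b[ by rewrite in_itv.
  apply: filterS => z; rewrite in_itv /= => /andP[az zb].
  by rewrite (Yq z) // (ltW az) (ltW zb).
have := aei_and (dY (i, false)) (aei_and (dY (i, true)) (aei_forall (fun j => BA i j))).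
apply: aeiS => x _ [d1 [d2 BAx]].
have split_sum (G : 'I_p.+1 * bool -> R) : \sum_r G r = \sum_j (G (j, false) + G (j, true)).
  transitivity (\sum_j \sum_(e : bool) G (j, e)).
    by rewrite pair_bigA /=; apply: eq_bigr => -[].
  by apply: eq_bigr => j _; rewrite big_bool addrC.
apply: complex_ext; rewrite /cderive /rhs /= ?Re_add ?Im_add ?Re_sum ?Im_sum.
  rewrite d1 split_sum /F /=; congr (_ + _); last by case: (i == ord_max).
  by apply: eq_bigr => j _; rewrite BAx Re_mul /M /=; ring.
rewrite d2 split_sum /F /=; congr (_ + _); last by case: (i == ord_max).
by apply: eq_bigr => j _; rewrite BAx Im_mul /M /=; ring.
Qed.

Lemma sol_lin u w h g (k : C) : sol u h -> sol w g ->
  sol (fun i x => k * u i x + w i x) (fun x => k * h x + g x).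
Proof.
move=> [u1 u2] [w1 w2]; split=> i.
  by apply: abs_contD => //; exact: abs_contZ.
have := aei_and (aei_and (u2 i) (w2 i))
  (aei_and (abs_cont_cderivable hab (u1 i)) (abs_cont_cderivable hab (w1 i))).
apply: aeiS => x _ [[e1 e2] [d1 d2]].
have dk : cderivable (fun t => k * u i t) x.
  exact: cderivableM (cderivable_cst k x) d1.
rewrite (cderiveD dk d2) (cderiveZ k d1) e1 e2 /rhs.
rewrite mulrDr addrACA mulr_sumr -big_split /=; congr (_ + _).
  by apply: eq_bigr => j _; ring.
by case: (i == ord_max); rewrite ?mulr0 ?addr0.
Qed.

Lemma sol_eq u h u' h' : (forall i x, u i x = u' i x) -> (forall x, h x = h' x) ->
  sol u h -> sol u' h'.
Proof.
move=> uu hh; have -> : u = u' by apply/funext => i; apply/funext => x.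
by have -> : h = h' by apply/funext.
Qed.

Lemma sol0 : sol (fun _ _ => 0) (fun=> 0).
Proof.
split=> i; first exact: abs_cont_cst.
apply: aeiW => x _; rewrite cderive_cst /rhs big1 ?add0r; last by move=> j _; rewrite mulr0.
by case: ifP.
Qed.

Lemma sol_sum (v : 'I_p.+1 -> 'I_p.+1 -> R -> C) c :
  (forall j, sol (v j) (fun=> 0)) ->
  sol (fun i x => \sum_j c j * v j i x) (fun=> 0).
Proof.
move=> H.
suff S (r : seq 'I_p.+1) : sol (fun i x => \sum_(j <- r) c j * v j i x) (fun=> 0).
  exact: S.
elim: r => [|j r IH].
  by apply: sol_eq sol0 => [i x|//]; rewrite big_nil.
apply: sol_eq (sol_lin (c j) (H j) IH) => [i x|x]; first by rewrite big_cons.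
by rewrite mulr0 addr0.
Qed.

(** Row k expresses the derivative of u_k through u_0, ..., u_{k+1}, with a nonzero coefficient at
    u_{k+1}; so u_{k+1} is determined by the components before it. The right-hand sides appear only
    in the last row, so [h] and [g] may differ. *)
Lemma sol_uniq u w h g : sol u h -> sol w g -> aei (fun x => u ord0 x = w ord0 x) ->
  forall i x, a <= x <= b -> u i x = w i x.
Proof.
move=> [u1 u2] [w1 w2] uw0.
have [A0 _ A1] := hA.
suff H n : forall i : 'I_p.+1, (i <= n)%N -> forall x, a <= x <= b -> u i x = w i x.
  by move=> i; exact: (H i).
elim: n => [|n IH] i.
  rewrite leqn0 => /eqP i0; have -> : i = ord0 by exact: val_inj.
  exact: abs_cont_ae_eq.
rewrite leq_eqVlt => /predU1P[iE|]; last by rewrite ltnS; exact: IH.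
apply: abs_cont_ae_eq => //.
have np : (n < p.+1)%N by rewrite (leq_trans _ (ltn_ord i)) // iE.
pose k := Ordinal np.
have kp : (k == ord_max) = false.
  by apply/negbTE; rewrite -val_eqE /= neq_ltn -ltnS -iE ltn_ord.
have Ai : aei (fun x => A x k i != 0) by apply: ae_aei; apply: A1.
have Aj : aei (fun x => forall j : 'I_p.+1, (k.+1 < j)%N -> A x k j = 0).
  apply: aei_forall => j; have [kj|_] := boolP (k.+1 < j)%N; last by apply: aeiW.
  by apply: aeiS (ae_aei (A0 _ _ kj)) => x _ /= ->.
have := aei_and (aei_and (u2 k) (w2 k)) (aei_and Ai Aj).
apply: aeiS => x /andP[ax xb] [[e1 e2] [Ax Bx]].
have xab : a <= x <= b by rewrite !ltW.
have uwk (j : 'I_p.+1) : (j <= n)%N -> u j x = w j x by move=> jn; exact: IH.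
have E : cderive (u k) x = cderive (w k) x.
  apply: (@cderive_eq _ a b); last by rewrite ax.
  by move=> y /andP[ay yb]; apply: (IH k) => //; rewrite !ltW.
move: E; rewrite e1 e2 /rhs kp !addr0 (bigD1 i) //= [RHS](bigD1 i) //=.
have -> : \sum_(j | j != i) A x k j * u j x = \sum_(j | j != i) A x k j * w j x.
  apply: eq_bigr => j ji; have [jn|nj] := leqP j n; first by rewrite uwk.
  rewrite Bx ?mul0r //= ltn_neqAle nj andbT.
  by apply: contra ji => /eqP E; apply/eqP/val_inj; exact: (esym (etrans iE E)).
by move=> /addIr /(mulfI Ax).
Qed.

Lemma sol_L2 u h i : sol u h -> L2 (u i).
Proof. by move=> [u1 _]; exact: Lp2_abs_cont. Qed.

End LinearSystem.

(** * Boundary values and orthogonality to the range *)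

Section BoundaryValues.
Context {R : realType}.
Variables (a b : R).
Hypothesis hab : a < b.
Variables (p : nat) (A : R -> 'M[R[i]]_p.+1).
Hypothesis hA : shin_zettl a b A.
Hypothesis hsym : aei a b (fun x => forall i j,
  A x i j = (-1) ^+ (i + j).+1 * (A x (rev_ord j) (rev_ord i))^*).
Local Notation C := R[i].
Local Notation mu := (@lebesgue_measure R).
Local Notation aei := (aei a b).
Local Notation cL1 := (cL1 a b).
Local Notation L2 := (Lp a b 2).
Local Notation ip := (L2_ip a b).
Local Notation sol := (sol a b A).
Implicit Types (u v w : 'I_p.+1 -> R -> C) (h g : R -> C) (c : 'I_p.+1 -> C).

Lemma cderive_sum (I : finType) (F : I -> R -> C) x :
  (forall i, cderivable (F i) x) ->
  cderive (fun t => \sum_i F i t) x = \sum_i cderive (F i) x.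
Proof.
move=> H.
suff [] : cderivable (fun t => \sum_i F i t) x /\
  cderive (fun t => \sum_i F i t) x = \sum_i cderive (F i) x by [].
elim: (index_enum I) => [|i r [IH1 IH2]].
  have -> : (fun t => \sum_(i <- [::]) F i t) = (fun=> 0).
    by apply/funext => t; rewrite big_nil.
  by rewrite big_nil cderive_cst; split => //; exact: cderivable_cst.
rewrite big_cons -IH2; move: IH1; set S := (fun t : R => \sum_(j <- r) F j t) => HS.
have -> : (fun t => \sum_(j <- i :: r) F j t) = (fun t => F i t + S t).
  by apply/funext => t; rewrite big_cons.
by split; [exact: (cderivableD (H i) HS)|exact: (cderiveD (H i) HS)].
Qed.

Definition values_at u x : 'I_p.+1 -> C := fun k => u k x.

Lemma green u v h g : sol u h -> sol v g -> L2 h -> L2 g ->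
  bracket (values_at u b) (values_at v b) - bracket (values_at u a) (values_at v a) =
  (-1) ^+ p * ip h (v ord0) + ip (u ord0) g.
Proof.
move=> Hu Hv Hh Hg; have [u1 u2] := Hu; have [v1 v2] := Hv.
have L1' : cL1 (fun x => (-1) ^+ p * (h x * (v ord0 x)^*)).
  by apply: cL1Z => //; apply: Lp2_mul => //; exact: sol_L2 Hv.
have L1'' : cL1 (fun x => u ord0 x * (g x)^*).
  by apply: Lp2_mul => //; exact: sol_L2 Hu.
rewrite /L2_ip -cintegralZ; last by apply: Lp2_mul => //; exact: sol_L2 Hv.
rewrite -cintegralD //.
have acb k : abs_cont a b (fun x => u k x * (v (rev_ord k) x)^*).
  by apply: abs_contM => //; exact: abs_cont_conj.
apply: (cFTC hab (f := fun x => bracket (values_at u x) (values_at v x))).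
- by apply: abs_cont_sum => k; apply: abs_contZ => //; exact: acb.
- exact: cL1D.
have := aei_and hsym (aei_forall (fun i => aei_and (aei_and (u2 i) (v2 i))
  (aei_and (abs_cont_cderivable hab (u1 i)) (abs_cont_cderivable hab (v1 i))))).
apply: aeiS => x _ [symx H].
rewrite mulrA -(bracket_derivative (values_at u x) (values_at v x) (h x) (g x) symx) /bracket.
rewrite -big_split /= cderive_sum; last first.
  move=> k; have [_ [du _]] := H k; have [_ [_ dv]] := H (rev_ord k).
  exact: cderivableM (cderivable_cst _ x) (cderivableM du (cderivable_conj dv)).
apply: eq_bigr => k _.
have [[e1 _] [du _]] := H k; have [[_ e2] [_ dv]] := H (rev_ord k).
have dvc := cderivable_conj dv.
rewrite (cderiveZ _ (cderivableM du dvc)) (cderiveM du dvc) (cderive_conj dv) e1 e2.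
by rewrite mulrDr.
Qed.

Lemma fundamental_system : exists v : 'I_p.+1 -> 'I_p.+1 -> R -> C,
  (forall j, sol (v j) (fun=> 0)) /\ forall j i, v j i a = (i == j)%:R.
Proof.
have z : cL1 (fun=> 0) by split; exact: L1_0.
have [v vP] := choice (fun j => sol_exists hab hA (fun i => (i == j)%:R) z).
by exists v; split=> j; have [] := vP j.
Qed.

Variable v : 'I_p.+1 -> 'I_p.+1 -> R -> C.
Hypothesis v_sol : forall j, sol (v j) (fun=> 0).
Hypothesis v_a : forall j i, v j i a = (i == j)%:R.

Let L2_0 : L2 (fun=> 0).
Proof. by apply: Lp2_abs_cont => //; exact: abs_cont_cst. Qed.

Let v0_L2 j : L2 (v j ord0).
Proof. exact: (sol_L2 hab ord0 (v_sol j)). Qed.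

Lemma ip0l f : L2 f -> ip (fun=> 0) f = 0.
Proof.
move=> Hf; transitivity (ip (fun x => 0 * (fun=> 0) x) f).
  by congr (ip _ f); apply/funext => x; rewrite mul0r.
by rewrite ipZl // mul0r.
Qed.

Lemma ip0r f : L2 f -> ip f (fun=> 0) = 0.
Proof. by move=> Hf; rewrite ipC // ip0l // rmorph0. Qed.

(* The brackets [v_i, v_j] are constant, and at [a] they form the matrix [- Lambda_mx]. *)
Lemma bracket_v_b_eq0 (beta : 'I_p.+1 -> C) :
  (forall j, bracket beta (values_at (v j) b) = 0) -> forall k, beta k = 0.
Proof.
move=> H.
pose P : 'M[C]_p.+1 := \matrix_(j, k) v j k b.
pose Q : 'M[C]_p.+1 := \matrix_(k, j) ((-1) ^+ k * (v j (rev_ord k) b)^*).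
have PQ : P *m Q = - @Lambda_mx R p.+1.
  apply/matrixP => i j; rewrite !mxE.
  have := green (v_sol i) (v_sol j) L2_0 L2_0.
  rewrite ip0l // ip0r // mulr0 addr0 => /eqP; rewrite subr_eq0 => /eqP.
  rewrite /bracket /values_at => E.
  transitivity (\sum_(k < p.+1) (-1) ^+ k * (v i k b * (v j (rev_ord k) b)^*)).
    by apply: eq_bigr => k _; rewrite !mxE mulrCA.
  rewrite E (bigD1 i) //= big1 ?addr0; last first.
    by move=> k ki; rewrite v_a (negbTE ki) mul0r mulr0.
  rewrite !v_a eqxx mul1r (eq_sym (rev_ord i)); case: eqP => _.
    by rewrite rmorph1 mulr1 exprS mulN1r opprK.
  by rewrite rmorph0 mulr0 oppr0.
have Qu : Q \in unitmx.
  have : - P *m Q \in unitmx by rewrite mulNmx PQ opprK; exact: Lambda_unit.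
  by rewrite unitmx_mul => /andP[].
pose B : 'rV[C]_p.+1 := \row_k beta k.
have BQ : B *m Q = 0.
  apply/rowP => j; rewrite !mxE -[RHS](H j) /bracket; apply: eq_bigr => k _.
  by rewrite !mxE mulrCA.
move=> k; have := congr1 (fun M : 'rV[C]_p.+1 => M 0 k) (mulmxK Qu B).
by rewrite /B BQ mul0mx !mxE.
Qed.

Let G : 'M[C]_p.+1 := \matrix_(i, j) ip (v i ord0) (v j ord0).

Definition combination c : R -> C := fun x => \sum_j c j * v j ord0 x.

Lemma combination_L2 c : L2 (combination c).
Proof. by apply: Lp2_sum => // j; exact: Lp2Z. Qed.

Lemma combination_ip c f : L2 f -> ip (combination c) f = \sum_j c j * ip (v j ord0) f.
Proof.
move=> Hf; rewrite /combination ip_suml //; last by move=> j; exact: Lp2Z.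
by apply: eq_bigr => j _; rewrite ipZl.
Qed.

Lemma combination_ip_v c j : ip (combination c) (v j ord0) = (\row_i c i *m G) 0 j.
Proof. by rewrite combination_ip // !mxE; apply: eq_bigr => i _; rewrite !mxE. Qed.

(** A combination is the component of index 0 of a homogeneous solution. If it vanishes so does the
    whole solution, and its data at [a] are the coefficients. *)
Lemma combination_eq0 c : aei (fun x => combination c x = 0) -> forall i, c i = 0.
Proof.
move=> H i; have S := sol_sum hab c v_sol.
have aa : a <= a <= b by rewrite lexx ltW.
have := sol_uniq hab hA S (sol0 a b A) H i aa.
rewrite (bigD1 i) //= big1 ?addr0 => [|j ji]; first by rewrite v_a eqxx mulr1.
by rewrite v_a eq_sym (negbTE ji) mulr0.
Qed.

(** A vector annihilated by the Gram matrix gives a combination orthogonal to every [v j ord0],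
    hence to itself. *)
Let G_unit : G \in unitmx.
Proof.
rewrite -row_free_unit; apply/inj_row_free => c cG.
pose d i := c 0 i.
have dc : \row_i d i = c by apply/rowP => i; rewrite mxE.
have H0 : ip (combination d) (combination d) = 0.
  rewrite combination_ip; last exact: combination_L2.
  rewrite big1 // => j _.
  rewrite ipC ?combination_ip_v ?dc ?cG //; try exact: combination_L2.
  by rewrite mxE rmorph0 mulr0.
apply/rowP => i; rewrite !mxE.
exact: (combination_eq0 (ip_eq0 (combination_L2 d) H0)).
Qed.

Lemma combination_moments (t : 'I_p.+1 -> C) :
  exists c, forall j, ip (combination c) (v j ord0) = t j.
Proof.
pose c := \row_i t i *m invmx G; exists (fun i => c 0 i) => j.
rewrite combination_ip_v.
have -> : \row_i c 0 i = c by apply/rowP => i; rewrite mxE.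
by rewrite /c mulmxKV // mxE.
Qed.

Lemma combination_cL1 c : cL1 (combination c).
Proof. by apply: Lp2_cL1 => //; exact: combination_L2. Qed.

Lemma prescribed_boundary_values (alpha beta : 'I_p.+1 -> C) :
  exists u h, [/\ L2 h, sol u h, (forall i, u i a = alpha i) &
    (forall i, u i b = beta i)].
Proof.
(* By [green], these moments of the right-hand side give the solution starting from [alpha] the same
   brackets with the [v j] at [b] as [beta] has. The sign is the one in [green], its own inverse. *)
pose t j := (-1) ^+ p * (bracket beta (values_at (v j) b) - bracket alpha (values_at (v j) a)).
have [c cP] := combination_moments t.
have [u [Hu ua]] := sol_exists hab hA alpha (combination_cL1 c).
exists u, (combination c); split => //; first exact: combination_L2.
move=> i; apply/eqP; rewrite -subr_eq0; apply/eqP.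
move: i; apply: bracket_v_b_eq0 => j.
rewrite bracketBl; apply/eqP; rewrite subr_eq0; apply/eqP.
have := green Hu (v_sol j) (combination_L2 c) L2_0.
rewrite cP ip0r ?addr0; last exact: sol_L2 Hu.
have -> : values_at u a = alpha by apply/funext => i; exact: ua.
rewrite /t mulrA -exprD addnn -mul2n exprM sqrrN expr1n expr1n mul1r.
by move=> /addIr.
Qed.

(** Let [w] be [f] minus its projection onto the span of the [v j ord0]. By [green] and
    [bracket_v_b_eq0], the solution with right-hand side [w] and zero data at [a] vanishes at [b]
    too. Hence [w] is orthogonal to [f], and also to the projection, so to itself. *)
Lemma orthogonal_to_range f : L2 f ->
  (forall u h, L2 h -> sol u h -> (forall i, u i a = 0) -> (forall i, u i b = 0) ->
     ip h f = 0) ->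
  exists c, aei (fun x => f x = combination c x).
Proof.
move=> Hf H.
have [c cP] := combination_moments (fun j => ip f (v j ord0)).
pose w x := f x - combination c x; exists c.
have Hw : L2 w by apply: Lp2B => //; exact: combination_L2.
have wv j : ip w (v j ord0) = 0 by rewrite ipBl // ?cP ?subrr //; exact: combination_L2.
have [u [Hu ua]] := sol_exists hab hA (fun=> 0) (Lp2_cL1 hab Hw).
have ub i : u i b = 0.
  move: i; apply: bracket_v_b_eq0 => j.
  have := green Hu (v_sol j) Hw L2_0.
  rewrite wv ip0r ?addr0 ?mulr0; last exact: sol_L2 Hu.
  rewrite [X in _ - X]/bracket [X in _ - X]big1 ?subr0 // => k _.
  by rewrite /values_at ua mul0r mulr0.
have wf : ip w f = 0 := H u w Hw Hu ua ub.
have wk : ip w (combination c) = 0.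
  rewrite ipC ?combination_ip //; last exact: combination_L2.
  by rewrite big1 ?rmorph0 // => j _; rewrite ipC // wv rmorph0 mulr0.
have : ip w w = 0 by rewrite ipBr // ?wf ?wk ?subrr //; exact: combination_L2.
move=> /(ip_eq0 Hw); apply: aeiS => x _ /eqP.
by rewrite subr_eq0 => /eqP.
Qed.

End BoundaryValues.

(** * Minimal and maximal operators *)

Section MaximalOperator.
Context {R : realType}.
Variables (a b : R).
Hypothesis hab : a < b.
Variables (p : nat) (A : R -> 'M[R[i]]_p.+1).
Hypothesis hA : shin_zettl a b A.
Local Notation C := R[i].
Local Notation mu := (@lebesgue_measure R).
Local Notation aei := (aei a b).
Local Notation cL1 := (cL1 a b).
Local Notation L2 := (Lp a b 2).
Local Notation ip := (L2_ip a b).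
Local Notation sol := (sol a b A).
Local Notation D := (quasi_derivative a b A).
Implicit Types (u v w : 'I_p.+1 -> R -> C) (y f g h : R -> C).

Lemma ac_rep_spec f g : abs_cont a b g -> aei (fun x => f x = g x) ->
  abs_cont a b (ac_rep a b f) /\ forall x, a <= x <= b -> ac_rep a b f x = g x.
Proof.
move=> Hg fg.
have [H1 H2] : abs_cont a b (ac_rep a b f) /\
    ae_eq mu `[a, b]%classic f (ac_rep a b f).
  by rewrite /ac_rep; apply: (xgetPex f (P := [set g | abs_cont a b g /\
    ae_eq mu `[a, b]%classic f g])); exists g; split => //; exact: aei_ae.
split => //; apply: abs_cont_ae_eq => //.
by apply: aeiS2 fg (ae_aei H2) => x _ <- <-.
Qed.

(** The default value of [ac_rep] is its argument, so the equality also holds when there is no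
    representative. *)
Lemma ac_rep_ae f : abs_cont a b (ac_rep a b f) -> aei (fun x => f x = ac_rep a b f x).
Proof.
move=> H.
have [[g [g1 g2]]|none] :=
  pselect (exists g, abs_cont a b g /\ ae_eq mu `[a, b]%classic f g).
  have [_ E] := ac_rep_spec g1 (ae_aei g2).
  apply: aeiS (ae_aei g2) => x /andP[ax xb] ->.
  by rewrite E // !ltW.
have E : ac_rep a b f = f.
  by rewrite /ac_rep xgetPN // => g Hg; apply: none; exists g.
by rewrite E; apply: aeiW.
Qed.

Lemma mxentryE (M : 'M[C]_p.+1) (i j : 'I_p.+1) : mxentry M i j = M i j.
Proof. by rewrite /mxentry !valK. Qed.

(** Each stage of [qd_upto] appends one function to a table and keeps the entries already there. *)
Lemma qd_upto_stable y k j : (j <= k)%N -> qd_upto a b A y k j = D j y.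
Proof.
elim: k => [|k IH]; first by rewrite leqn0 => /eqP ->.
rewrite leq_eqVlt ltnS => /predU1P[->//|jk].
by rewrite /= jk IH.
Qed.

Lemma qd_step_D y k x : qd_step A (qd_upto a b A y k) k x =
  cderive (D k y) x - \sum_(s < k.+1) mxentry (A x) k s * D s y x.
Proof.
rewrite /qd_step; congr (_ - _); apply: eq_bigr => s _.
by rewrite qd_upto_stable // -ltnS.
Qed.

Lemma quasi_derivativeS y k : (k.+1 < p.+1)%N -> D k.+1 y = ac_rep a b (fun x =>
  (mxentry (A x) k k.+1)^-1 *
  (cderive (D k y) x - \sum_(s < k.+1) mxentry (A x) k s * D s y x)).
Proof.
move=> kp; rewrite /quasi_derivative /= ltnn kp; congr ac_rep; apply/funext => x.
by rewrite qd_step_D.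
Qed.

Lemma quasi_derivative_last y x : D p.+1 y x =
  cderive (D p y) x - \sum_(s < p.+1) mxentry (A x) p s * D s y x.
Proof. by rewrite /quasi_derivative /= !ltnn qd_step_D. Qed.

Lemma sum_below (F : nat -> C) (k : nat) : (k <= p.+1)%N ->
  \sum_(s < k) F s = \sum_(j < p.+1 | (j < k)%N) F j.
Proof. by move=> kp; rewrite (big_ord_widen _ F kp). Qed.

Lemma row_sum (i j : 'I_p.+1) (w : 'I_p.+1 -> C) x : j = i.+1 :> nat ->
  (forall l : 'I_p.+1, (i.+1 < l)%N -> A x i l = 0) ->
  \sum_l A x i l * w l = \sum_(l < p.+1 | (l < i.+1)%N) A x i l * w l + A x i j * w j.
Proof.
move=> ji H; rewrite (bigID (fun l : 'I_p.+1 => (l < i.+1)%N)) /=; congr (_ + _).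
rewrite (bigD1 j) /=; last by rewrite ji ltnn.
rewrite big1 ?addr0 // => l /andP[li lj]; rewrite H ?mul0r //.
by rewrite ltn_neqAle leqNgt li andbT -ji eq_sym; apply: contra lj => /eqP/val_inj ->.
Qed.

Lemma row_ae (i j : 'I_p.+1) : j = i.+1 :> nat ->
  aei (fun x => A x i j != 0 /\ forall l : 'I_p.+1, (i.+1 < l)%N -> A x i l = 0).
Proof.
have [A0 _ A1] := hA; move=> ji; apply: aei_and; first exact: ae_aei (A1 _ _ ji).
apply: aei_forall => l; have [il|_] := boolP (i.+1 < l)%N; last by apply: aeiW.
by apply: aeiS (ae_aei (A0 _ _ il)) => x _ /= ->.
Qed.

(** Induction on the order: if the quasi-derivatives up to k agree with the components on [a, b], so
    do their derivatives inside, and solving row k for u_{k+1} reproduces the recursion. The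
    absolutely continuous representative selected is then u_{k+1}. *)
Lemma sol_quasi_derivative u h y : sol u h -> aei (fun x => y x = u ord0 x) ->
  forall i : 'I_p.+1, abs_cont a b (D i y) /\ forall x, a <= x <= b -> D i y x = u i x.
Proof.
move=> [u1 u2] yu.
suff H k : forall i : 'I_p.+1, (i <= k)%N ->
    abs_cont a b (D i y) /\ forall x, a <= x <= b -> D i y x = u i x.
  by move=> i; exact: (H i).
elim: k => [|k IH] i.
  rewrite leqn0 => /eqP i0; have -> : i = ord0 by exact: val_inj.
  exact: ac_rep_spec.
rewrite leq_eqVlt => /predU1P[iE|]; last by rewrite ltnS; exact: IH.
have kp1 : (k.+1 < p.+1)%N by rewrite -iE.
pose j := Ordinal (ltnW kp1).
rewrite iE quasi_derivativeS //; apply: ac_rep_spec => //.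
have jp : (j == ord_max) = false.
  by apply/negbTE; rewrite -val_eqE /= neq_ltn -ltnS kp1.
apply: aeiS2 (row_ae (i := j) iE) (u2 j) => x /andP[ax xb] [Ax Bx] E.
have xab : a <= x <= b by rewrite !ltW.
have -> : cderive (D k y) x = cderive (u j) x.
  apply: (@cderive_eq _ a b); last by rewrite ax.
  by move=> t /andP[ta tb]; apply: (IH j (leqnn _)).2; rewrite !ltW.
have /= RS := @row_sum j i (fun l => u l x) x iE Bx.
rewrite E /rhs jp addr0 RS.
rewrite (sum_below (fun s => mxentry (A x) k s * D s y x)) //; last exact: ltnW.
have -> : mxentry (A x) k k.+1 = A x j i by rewrite -(mxentryE (A x) j i) iE.
have -> : \sum_(l < p.+1 | (l < k.+1)%N) mxentry (A x) k l * D l y x =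
    \sum_(l < p.+1 | (l < j.+1)%N) A x j l * u l x.
  apply: eq_bigr => l lk; rewrite (mxentryE (A x) j l); congr (_ * _).
  by apply: (IH l _).2.
by rewrite addrC addKr mulKf.
Qed.

Lemma quasi_derivative_eq_expr u h y : sol u h -> aei (fun x => y x = u ord0 x) ->
  aei (fun x => D p.+1 y x = h x).
Proof.
move=> Hu yu; have H := sol_quasi_derivative Hu yu; have [u1 u2] := Hu.
apply: aeiS (u2 ord_max) => x /andP[ax xb] E.
have xab : a <= x <= b by rewrite !ltW.
rewrite quasi_derivative_last.
have -> : cderive (D p y) x = cderive (u ord_max) x.
  apply: (@cderive_eq _ a b); last by rewrite ax.
  by move=> t /andP[ta tb]; apply: (H ord_max).2; rewrite !ltW.
rewrite E /rhs eqxx.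
have -> : \sum_(s < p.+1) mxentry (A x) p s * D s y x = \sum_j A x ord_max j * u j x.
  apply: eq_bigr => s _; rewrite (mxentryE (A x) ord_max s); congr (_ * _).
  exact: (H s).2.
by rewrite addrC addKr.
Qed.

Definition ipow : C := ('i%C : C) ^+ p.+1.

Lemma ipow_sqr : ipow * ipow = (-1) ^+ p.+1.
Proof. by rewrite /ipow -exprMn -expr2 sqr_i. Qed.

Lemma ipow_neq0 : ipow != 0.
Proof.
apply: contraTneq (oner_neq0 C) => E; have := ipow_sqr.
by rewrite E mul0r => /esym/eqP; rewrite signr_eq0.
Qed.

Lemma ipow_conj : ipow^* = ipow^-1.
Proof.
have i1 : ('i%C : C)^* * ('i%C : C) = 1.
  by apply: complex_ext; rewrite ?complexpE /=; ring.
apply: (mulIf ipow_neq0); rewrite mulVf ?ipow_neq0 //.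
by rewrite /ipow rmorphXn /= -exprMn i1 expr1n.
Qed.

(** With [sol_L_max], the dictionary between the operator and the system. The factor [ipow^-1]
    undoes the i^m in the differential expression. *)
Lemma L_max_sol y l : L_max a b A (y, l) ->
  [/\ L2 y, L2 l, sol (fun i => D i y) (fun x => ipow^-1 * l x) &
      aei (fun x => y x = D (@ord0 p) y x)].
Proof.
case=> /= Hy Hl dom lD; split => //; last by apply: ac_rep_ae; exact: (dom 0%N).
split=> [i|i]; first exact: dom.
have [ip|ip] := eqVneq i ord_max.
  have lD' := ae_aei lD; apply: aeiS lD' => x _ E.
  rewrite /rhs ip eqxx E /quasi_diff_expr mulKf ?ipow_neq0 // quasi_derivative_last.
  have -> : \sum_(s < p.+1) mxentry (A x) p s * D s y x = \sum_j A x ord_max j * D j y x.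
    by apply: eq_bigr => s _; rewrite (mxentryE (A x) ord_max s).
  by rewrite addrC subrK.
have ip1 : (i.+1 < p.+1)%N.
  by rewrite ltnS ltn_neqAle -ltnS ltn_ord andbT.
pose j := Ordinal ip1; have ji : j = i.+1 :> nat by [].
(* [ac_rep] gives the recursion almost everywhere; multiplied by the nonzero superdiagonal entry it
   becomes row [i] of the system. *)
have := dom _ ip1; rewrite quasi_derivativeS // => /ac_rep_ae; rewrite -quasi_derivativeS //.
move=> E; apply: aeiS2 (row_ae ji) E => x _ [Ax Bx].
have /= RS := @row_sum i j (fun l => D l y x) x ji Bx.
rewrite (mxentryE (A x) i j) /rhs (negbTE ip) addr0 RS => <-.
rewrite mulVKf // (sum_below (fun s => mxentry (A x) i s * D s y x)) //.
set S := \sum_(l < _ | _) _; set S' := \sum_(l < _ | _) _.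
have -> : S = S' by apply: eq_bigr => l' _; rewrite (mxentryE (A x) i l').
by rewrite addrC subrK.
Qed.

Lemma sol_L_max u y l : sol u (fun x => ipow^-1 * l x) -> L2 y -> L2 l ->
  aei (fun x => y x = u ord0 x) -> L_max a b A (y, l).
Proof.
move=> Hu Hy Hl yu; split => //=.
  move=> k kp; exact: (sol_quasi_derivative Hu yu (Ordinal kp)).1.
apply: aei_ae; apply: aeiS (quasi_derivative_eq_expr Hu yu) => x _ E.
by rewrite /quasi_diff_expr E mulVKf ?ipow_neq0.
Qed.

Hypothesis hsym : aei (fun x => forall i j,
  A x i j = (-1) ^+ (i + j).+1 * (A x (rev_ord j) (rev_ord i))^*).

Lemma lagrange_identity f f' g g' : L_max a b A (f, f') -> L_max a b A (g, g') ->
  bracket (fun k : 'I_p.+1 => D k f b) (fun k => D k g b) -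
  bracket (fun k : 'I_p.+1 => D k f a) (fun k => D k g a) =
  - ipow * (ip f' g - ip f g').
Proof.
move=> /L_max_sol[Hf Hf' sf ff] /L_max_sol[Hg Hg' sg gg].
have Lf : L2 (D (@ord0 p) f) := sol_L2 hab ord0 sf.
have Lg : L2 (D (@ord0 p) g) := sol_L2 hab ord0 sg.
rewrite (green hab hsym sf sg (Lp2Z _ Hf') (Lp2Z _ Hg')) ipZl // ipZr //.
rewrite rmorphV ?unitfE ?ipow_neq0 //= ipow_conj invrK mulrA.
(* As [ipow] squared is (-1)^(p+1) and the conjugate of [ipow^-1] is [ipow], both terms of [green]
   acquire the same factor up to sign. *)
have -> : (-1) ^+ p / ipow = - ipow.
  apply: (mulIf ipow_neq0); rewrite mulfVK ?ipow_neq0 //.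
  by rewrite mulNr ipow_sqr exprS mulN1r opprK.
have -> : ip f' (D (@ord0 p) g) = ip f' g.
  apply: ip_ae => //; first exact: aeiW.
  by apply: aeiS gg => x _ ->.
have -> : ip (D (@ord0 p) f) g' = ip f g'.
  apply: ip_ae => //; last exact: aeiW.
  by apply: aeiS ff => x _ ->.
by rewrite mulrBr mulNr mulNr opprK.
Qed.

Lemma L_max_sub_adjoint : L_max a b A `<=` op_adjoint L2 ip (L_min a b A).
Proof.
case=> f f' Hf; split; [by case: Hf|by case: Hf|].
move=> [g g'] [Hg bg] /=; have := lagrange_identity Hg Hf.
rewrite /bracket big1 ?big1 => [|k _|k _].
- move=> /esym/eqP; rewrite subrr mulf_eq0 oppr_eq0 (negbTE ipow_neq0) /= subr_eq0.
  by move/eqP.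
- by have [-> _] := bg k (ltn_ord k); rewrite mul0r mulr0.
- by have [_ ->] := bg k (ltn_ord k); rewrite mul0r mulr0.
Qed.

(* Subtracting a solution of [l(u) = f'] from [f] leaves a function orthogonal to the
   range of [L_min], that is, a solution of the homogeneous equation. *)
Lemma adjoint_sub_L_max : op_adjoint L2 ip (L_min a b A) `<=` L_max a b A.
Proof.
case=> f f' [/= Hf Hf' H].
have [v [v_sol v_a]] := fundamental_system hab hA.
have Hf'' : L2 (fun x => ipow^-1 * f' x) by exact: Lp2Z.
have [u [Hu ua]] := sol_exists hab hA (fun=> 0) (Lp2_cL1 hab Hf'').
have Lu : L2 (u ord0) := sol_L2 hab ord0 Hu.
have umax : L_max a b A (u ord0, f').
  by apply: (sol_L_max Hu) => //; exact: aeiW.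
have Hg : L2 (fun x => f x - u ord0 x) by exact: Lp2B.
have [|c cP] := orthogonal_to_range hab hA hsym v_sol v_a Hg.
  move=> w h Hh Hw wa wb.
  have aa : a <= a <= b by rewrite lexx ltW.
  have bb : a <= b <= b by rewrite lexx ltW.
  have w0 : L2 (w ord0) := sol_L2 hab ord0 Hw.
  have Hkh : L2 (fun x => ipow * h x) by exact: Lp2Z.
  have Hw' : sol w (fun x => ipow^-1 * (ipow * h x)).
    by apply: sol_eq Hw => // x; rewrite mulKf ?ipow_neq0.
  have ww : aei (fun x => w ord0 x = w ord0 x) by exact: aeiW.
  have wmin : L_min a b A (w ord0, fun x => ipow * h x).
    split; first exact: sol_L_max Hw' _ _ ww.
    move=> k kp /=; have [_ E] := sol_quasi_derivative Hw' ww (Ordinal kp).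
    by rewrite (E a aa) (E b bb) wa wb.
  have E1 := H _ wmin; have [_ _ E2] := L_max_sub_adjoint umax; have {}E2 := E2 _ wmin.
  move: E1 E2; rewrite /= !ipZl // => <- /(mulfI ipow_neq0) E.
  by rewrite ipBr // E subrr.
have S := sol_sum hab c v_sol.
have Hz := sol_lin hab 1 Hu S.
have Hz' : sol (fun i x => u i x + \sum_j c j * v j i x) (fun x => ipow^-1 * f' x).
  by apply: sol_eq Hz => [i x|x]; rewrite mul1r ?addr0.
apply: (sol_L_max Hz') => //; apply: aeiS cP => x _ /eqP.
by rewrite subr_eq addrC => /eqP.
Qed.

Lemma op_adjoint_L_min : op_adjoint L2 ip (L_min a b A) = L_max a b A.
Proof.
apply/seteqP; split; [exact: adjoint_sub_L_max|exact: L_max_sub_adjoint].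
Qed.

(** Representatives are selected by choice, so linearity comes from [sol_lin] and uniqueness, and
    holds only on [a, b]. *)
Lemma quasi_derivative_lin (c : C) f f' g g' : L_max a b A (f, f') -> L_max a b A (g, g') ->
  forall k, (k < p.+1)%N -> forall x, a <= x <= b ->
    D k (c *: f + g) x = c * D k f x + D k g x.
Proof.
move=> /L_max_sol[Hf Hf' sf ff] /L_max_sol[Hg Hg' sg gg] k kp.
have S := sol_lin hab c sf sg.
apply: (sol_quasi_derivative S _ (Ordinal kp)).2.
by apply: aeiS2 ff gg => x _ <- <-.
Qed.

Lemma L_max_boundary_values (alpha beta : 'I_p.+1 -> C) : exists f f',
  [/\ L_max a b A (f, f'), forall k : 'I_p.+1, D k f a = alpha k &
      forall k : 'I_p.+1, D k f b = beta k].
Proof.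
have [v [v_sol v_a]] := fundamental_system hab hA.
have [u [h [Hh Hu ua ub]]] := prescribed_boundary_values hab hA hsym v_sol v_a alpha beta.
have aa : a <= a <= b by rewrite lexx ltW.
have bb : a <= b <= b by rewrite lexx ltW.
have uu : aei (fun x => u ord0 x = u ord0 x) by exact: aeiW.
have Hu' : sol u (fun x => ipow^-1 * (ipow * h x)).
  by apply: sol_eq Hu => // x; rewrite mulKf ?ipow_neq0.
exists (u ord0), (fun x => ipow * h x); split.
- by apply: (sol_L_max Hu') => //; [exact: sol_L2 Hu|exact: Lp2Z].
- by move=> k; rewrite (sol_quasi_derivative Hu uu k).2.
- by move=> k; rewrite (sol_quasi_derivative Hu uu k).2.
Qed.

End MaximalOperator.

(** * The boundary maps *)

Section BoundaryMaps.
Context {R : realType}.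
Variables (p n : nat).
Local Notation C := R[i].
Local Notation m := p.+1.
Local Notation kappa := (@ipow R p).
Hypothesis hm : m = n.*2 \/ m = n.*2.+1.
Implicit Types (al be : nat -> C).

Definition gamma : C := (-1) ^+ n / 2%:R + 'i%C.
Definition delta : C := (-1) ^+ n.+1 / 2%:R + 'i%C.

(* [Gamma1] and [Gamma2] as functions of the values at [a] and [b] of the
   quasi-derivatives, [al k = D k y a] and [be k = D k y b]. *)
Definition boundary1 al be (i : nat) : C :=
  kappa * (if (i < n)%N then (-1) ^+ i.+1 * al (m - i.+1)%N
           else if (i < n.*2)%N then (-1) ^+ (i - n) * be (m - (i - n).+1)%N
           else 1 * be n + 1 * al n).

Definition boundary2 al be (i : nat) : C :=
  if (i < n)%N then al i
  else if (i < n.*2)%N then be (i - n)%N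
  else gamma * be n + delta * al n.

Definition nat_bracket al al' : C := \sum_(k < m) (-1) ^+ k * (al k * (al' (p - k)%N)^*).

Lemma boundary_ext al be al' be' : (forall k, (k < m)%N -> al k = al' k) ->
  (forall k, (k < m)%N -> be k = be' k) ->
  forall i, (i < m)%N ->
    boundary1 al be i = boundary1 al' be' i /\ boundary2 al be i = boundary2 al' be' i.
Proof.
move=> Ha Hb i im; rewrite /boundary1 /boundary2.
have [i1|i1] := ltnP i n; first by rewrite !Ha //; lia.
have [i2|i2] := ltnP i n.*2; first by rewrite !Hb //; lia.
by rewrite Ha ?Hb //; lia.
Qed.

Lemma boundary_lin c al be al' be' i :
  boundary1 (fun k => c * al k + al' k) (fun k => c * be k + be' k) i =
    c * boundary1 al be i + boundary1 al' be' i /\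
  boundary2 (fun k => c * al k + al' k) (fun k => c * be k + be' k) i =
    c * boundary2 al be i + boundary2 al' be' i.
Proof.
by rewrite /boundary1 /boundary2; case: ifP => _; [|case: ifP => _]; split; ring.
Qed.

(** Groups the entries [i] and [n + i] of a boundary map, which carry the same order at [a] and at
    [b]. *)
Lemma sum_pairs_shift (F : nat -> C) : \sum_(i < m) F i =
  \sum_(i < n) (F i + F (n + i)%N) + (if odd m then F n.*2 else 0).
Proof.
have even : \sum_(i < n.*2) F i = \sum_(i < n) (F i + F (n + i)%N).
  by rewrite -addnn big_split_ord big_split.
case: hm => ->; first by rewrite odd_double addr0.
by rewrite big_ord_recr /= odd_double even.
Qed.

(** Groups the orders [i] and [p - i], which are multiplied together in the bracket. *)
Lemma sum_pairs_rev (F : nat -> C) : \sum_(i < m) F i =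
  \sum_(i < n) (F i + F (p - i)%N) + (if odd m then F n else 0).
Proof.
rewrite big_split /= -addrA -[~~ odd p]/(odd m).
case: hm => mE.
  have -> : \sum_(i < m) F i = \sum_(i < n + n) F i by rewrite mE addnn.
  rewrite mE odd_double addr0 big_split_ord /=; congr (_ + _).
  rewrite (reindex_inj rev_ord_inj) /=; apply: eq_bigr => i _; congr F.
  by have := ltn_ord i; lia.
have -> : \sum_(i < m) F i = \sum_(i < n + n.+1) F i by rewrite mE addnS addnn.
rewrite mE oddS odd_double big_split_ord /=; congr (_ + _).
rewrite big_ord_recl /= addn0 addrC; congr (_ + _).
rewrite (reindex_inj rev_ord_inj) /=; apply: eq_bigr => i _; congr F.
by have := ltn_ord i; rewrite /bump /=; lia.
Qed.

Lemma conj_sign (k : nat) : ((-1) ^+ k : C)^* = (-1) ^+ k.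
Proof. by rewrite rmorphXn /= rmorphN1. Qed.

Lemma conj_i : ('i%C : C)^* = - 'i%C.
Proof. by apply: complex_ext; rewrite ?complexpE /= ?oppr0. Qed.

Lemma conj_gamma : gamma^* = (-1) ^+ n / 2%:R - 'i%C.
Proof. by rewrite /gamma rmorphD rmorphM /= conj_sign fmorphV /= rmorph_nat conj_i. Qed.

Lemma conj_delta : delta^* = (-1) ^+ n.+1 / 2%:R - 'i%C.
Proof. by rewrite /delta rmorphD rmorphM /= conj_sign fmorphV /= rmorph_nat conj_i. Qed.

(** Each pair of entries of the maps matches one pair of orders in the bracket. For odd m, [kappa]
    squared is -1, and with alpha = beta = 1 the middle term asks for 2 Re gamma = (-1)^n, 2 Re
    delta = -(-1)^n and gamma = - conj(delta). The real parts are thus forced, while the common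
    imaginary part is free; here it is 1. *)
Lemma boundary_green al be al' be' :
  \sum_(i < m) boundary1 al be i * (boundary2 al' be' i)^* -
  \sum_(i < m) boundary2 al be i * (boundary1 al' be' i)^* =
  - kappa^-1 * (nat_bracket be be' - nat_bracket al al').
Proof.
have k0 := @ipow_neq0 R p.
rewrite -sumrB /nat_bracket -sumrB.
rewrite (sum_pairs_shift (fun i => boundary1 al be i * (boundary2 al' be' i)^* -
  boundary2 al be i * (boundary1 al' be' i)^*)).
rewrite (sum_pairs_rev (fun k => (-1) ^+ k * (be k * (be' (p - k)%N)^*) -
  (-1) ^+ k * (al k * (al' (p - k)%N)^*))).
rewrite mulrDr mulr_sumr; congr (_ + _).
  apply: eq_bigr => i _; have iln := ltn_ord i.
  have ip : (i <= p)%N by lia.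
  have e1 : (n + i < n)%N = false by lia.
  have e2 : (n + i < n.*2)%N by lia.
  rewrite /boundary1 /boundary2 iln e1 e2 addKn.
  have -> : (m - i.+1 = p - i)%N by lia.
  rewrite subKn //.
  (* Writing the parity of [p] through [kappa] leaves an identity of rational functions. *)
  have -> : (-1) ^+ (p - i) = - (kappa * kappa) * (-1) ^+ i :> C.
    rewrite ipow_sqr exprS mulN1r opprK -exprD; apply: signr_odd_eq.
    by rewrite oddB // oddD.
  rewrite !rmorphM /= !conj_sign ipow_conj exprS.
  by field.
case: ifP => modd; last by rewrite mulr0.
have mE : p = n.*2 by case: hm modd => [->|[]//]; rewrite odd_double.
have e1 : (n.*2 < n)%N = false by lia.
have e3 : (p - n = n)%N by lia.
rewrite /boundary1 /boundary2 e1 ltnn e3.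
have kk : kappa^-1 = - kappa.
  apply: (mulIf k0); rewrite mulVf // mulNr ipow_sqr -signr_odd modd expr1 opprK //.
rewrite !rmorphM !rmorphD !rmorphM /= conj_gamma conj_delta ipow_conj kk rmorph1.
rewrite /gamma /delta !exprS.
by field.
Qed.

Lemma boundary_surj (w1 w2 : 'cV[C]_m) : exists al be, forall i : 'I_m,
  boundary1 al be i = w1 i 0 /\ boundary2 al be i = w2 i 0.
Proof.
have k0 := @ipow_neq0 R p.
pose wn (w : 'cV[C]_m) k := if insub k is Some j then w j 0 else 0.
have wnE w (i : 'I_m) : wn w i = w i 0 by rewrite /wn valK.
(* For odd m, [s] is the sum of the two middle values as prescribed by [w1]. The last entry of the
   second map is then (gamma - delta) [bn] + delta [s], and gamma - delta = (-1)^n is invertible.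
   For even m the index [n.*2] is out of range and the last branches of [al] and [be] are not
   reached. *)
pose s := kappa^-1 * wn w1 n.*2.
pose bn := (-1) ^+ n * (wn w2 n.*2 - delta * s).
pose al k := if (k < n)%N then wn w2 k
  else if (p - k < n)%N then (-1) ^+ (m - k) * kappa^-1 * wn w1 (p - k)%N else s - bn.
pose be k := if (k < n)%N then wn w2 (n + k)%N
  else if (p - k < n)%N then (-1) ^+ (p - k) * kappa^-1 * wn w1 (n + (p - k))%N else bn.
have ss k : (-1) ^+ k * (-1) ^+ k = 1 :> C.
  by rewrite -exprD addnn -mul2n exprM sqrrN expr1n expr1n.
exists al, be => i; have im := ltn_ord i.
rewrite -!wnE /boundary1 /boundary2; case: (ltnP i n) => i1.
  rewrite {2}/al i1; split => //.
  have e1 : (m - i.+1 < n)%N = false by lia.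
  have e2 : (p - (m - i.+1) = i)%N by lia.
  have e3 : (m - (m - i.+1) = i.+1)%N by lia.
  rewrite /al e1 e2 i1 e3.
  by rewrite !mulrA -(mulrA kappa) ss mulr1 divff // mul1r.
case: (ltnP i n.*2) => i2.
  have e0 : (i - n < n)%N by lia.
  have e0' : (n + (i - n) = i)%N by lia.
  rewrite {2}/be e0 e0'; split => //.
  have e1 : (m - (i - n).+1 < n)%N = false by lia.
  have e2 : (p - (m - (i - n).+1) = i - n)%N by lia.
  rewrite /be e1 e2 e0 e0'.
  by rewrite !mulrA -(mulrA kappa) ss mulr1 divff // mul1r.
have iE : i = n.*2 :> nat by lia.
have e1 : (p - n < n)%N = false by lia.
rewrite /al /be ltnn e1 iE; split.
  by rewrite !mul1r addrC subrK /s mulVKf.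
have -> : gamma * bn + delta * (s - bn) = (gamma - delta) * bn + delta * s by ring.
have -> : gamma - delta = (-1) ^+ n by rewrite /gamma /delta exprS; field.
by rewrite /bn mulrA ss mul1r subrK.
Qed.

End BoundaryMaps.

(** Once the adjoint is identified with [L_max], every clause is a statement about the values of the
    quasi-derivatives at the two ends. *)
Lemma boundary_triplet_quasi_derivatives (R : realType) (a b : R) (p n : nat)
    (A : R -> 'M[R[i]]_p.+1) (hab : a < b)
    (hm : p.+1 = n.*2 \/ p.+1 = n.*2.+1)
    (hA : shin_zettl a b A)
    (hAadj : ae_eq (@lebesgue_measure R) `[a, b]%classic A (formal_adjoint A)) :
  boundary_triplet (Lp a b 2) (@L2_ip R a b) (L_min a b A)
    (@cdot R[i] p.+1) (Gamma1 a b A n) (Gamma2 a b A n).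
Proof.
have hsym : aei a b (fun x => forall i j,
    A x i j = (-1) ^+ (i + j).+1 * (A x (rev_ord j) (rev_ord i))^*).
  apply: aeiS (ae_aei hAadj) => x _ E i j.
  by rewrite {1}E formal_adjointE.
have Tadj := op_adjoint_L_min hab hA hsym.
pose D k y := quasi_derivative a b A k y.
have G1E y i : Gamma1 a b A n y i 0 = boundary1 p n (fun k => D k y a) (fun k => D k y b) i.
  by rewrite mxE.
have G2E y i : Gamma2 a b A n y i 0 = boundary2 n (fun k => D k y a) (fun k => D k y b) i.
  by rewrite mxE.
have aa : a <= a <= b by rewrite lexx ltW.
have bb : a <= b <= b by rewrite lexx ltW.
have lin c f g : op_dom (L_max a b A) f -> op_dom (L_max a b A) g -> forall i : 'I_p.+1,
    boundary1 p n (fun k => D k (c *: f + g) a) (fun k => D k (c *: f + g) b) i =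
      c * boundary1 p n (fun k => D k f a) (fun k => D k f b) i +
      boundary1 p n (fun k => D k g a) (fun k => D k g b) i /\
    boundary2 n (fun k => D k (c *: f + g) a) (fun k => D k (c *: f + g) b) i =
      c * boundary2 n (fun k => D k f a) (fun k => D k f b) i +
      boundary2 n (fun k => D k g a) (fun k => D k g b) i.
  move=> [f' Hf] [g' Hg] i.
  have L := quasi_derivative_lin hab hA c Hf Hg.
  have [-> ->] := boundary_ext hm (fun k kp => L k kp a aa) (fun k kp => L k kp b bb) (ltn_ord i).
  exact: boundary_lin.
rewrite /boundary_triplet Tadj; split.
- move=> c f g Hf Hg; apply/colP => i; rewrite [LHS]G1E (lin c f g Hf Hg i).1.
  by rewrite -!G1E !mxE.
- move=> c f g Hf Hg; apply/colP => i; rewrite [LHS]G2E (lin c f g Hf Hg i).2.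
  by rewrite -!G2E !mxE.
- move=> f f' g g' Hf Hg.
  have := lagrange_identity hab hA hsym Hf Hg.
  rewrite /cdot.
  under eq_bigr do rewrite G1E G2E.
  under [X in _ = _ - X]eq_bigr do rewrite G1E G2E.
  rewrite (boundary_green hm).
  have cr x : bracket (fun k : 'I_p.+1 => D k f x) (fun k : 'I_p.+1 => D k g x) =
      nat_bracket p (fun k => D k f x) (fun k => D k g x).
    by apply: eq_bigr => k _; rewrite /= subSS.
  rewrite -!cr => ->.
  by rewrite !mulNr mulrN opprK mulKf ?ipow_neq0.
move=> w1 w2; have [al [be H]] := boundary_surj hm w1 w2.
have [f [f' [Hf fa fb]]] := L_max_boundary_values hab hA hsym
  (fun k : 'I_p.+1 => al k) (fun k : 'I_p.+1 => be k).
have fa' k : (k < p.+1)%N -> D k f a = al k by move=> kp; exact: (fa (Ordinal kp)).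
have fb' k : (k < p.+1)%N -> D k f b = be k by move=> kp; exact: (fb (Ordinal kp)).
have E (i : 'I_p.+1) := boundary_ext hm (al := fun k => D k f a) (be := fun k => D k f b)
  fa' fb' (ltn_ord i).
exists f; split; first by exists f'.
  by apply/colP => i; rewrite G1E -(H i).1; exact: (E i).1.
by apply/colP => i; rewrite G2E -(H i).2; exact: (E i).2.
Qed.

Theorem lemma4 (R : realType) (a b : R) (m n : nat) (A : R -> 'M[R[i]]_m)
    (hab : a < b)
    (hm : (m = n.*2 /\ (2 <= n)%N) \/ (m = n.*2.+1 /\ (1 <= n)%N))
    (hA : shin_zettl a b A)
    (hAadj : ae_eq (@lebesgue_measure R) `[a, b]%classic A (formal_adjoint A)) :
  boundary_triplet (Lp a b 2) (@L2_ip R a b) (L_min a b A)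
    (@cdot R[i] m) (Gamma1 a b A n) (Gamma2 a b A n).
Proof.
(* The order is made a successor so that first and last components exist; [hm] excludes 0. *)
case: m A hm hA hAadj => [|p] A hm hA hAadj.
  by case: hm => -[]; lia.
apply: boundary_triplet_quasi_derivatives => //.
by case: hm => -[-> _]; [left|right].
Qed.
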